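(* Let $(N_n)_{n\in\mathbb N}$ be independent standard normal random variables and $(X_n)_{n\in\mathbb N}$ independent standard Brownian motions on $[0,1]$ (independent of the $N_n$), and let $f_n(t)=N_n+X_n(t)$ for $t\in[0,1]$. Then almost surely the collection $\{f_n:n\in\mathbb N\}$ is IC-dense.
   Context: A standard Brownian motion $X$ on $[0,1]$ has $X(0)=0$, continuous paths, $\mathbb E X(t)=0$ and $\mathrm{Var}\,X(t)=t$ (with independent Gaussian increments). $C[0,1]$ is the space of continuous real functions on $[0,1]$ with the sup norm. For $x\in\mathbb R$, $\langle x\rangle=x-\lfloor x\rfloor$, and $\mathsf{cr}(f,g)=\{x\in[0,1]:\langle f(x)\rangle=\langle g(x)\rangle\}$. A countable $V\subseteq C[0,1]$ is IC-dense if: (1) $V$ is dense in $C[0,1]$; (2) the sets $\mathsf{cr}(f,g)$ are pairwise disjoint for distinct pairs $\{f,g\}$ of distinct elements of $V$; (3) for distinct $f,g\in V$, $\mathsf{cr}(f,g)$ contains neither $0$ nor $1$; (4) for each distinct pair $f,g\in V$, if $\langle f(x)\rangle=\langle g(x)\rangle$ with $x\in(0,1)$, then there is a sequence $x_n$ converging monotonically to $x$ with $\langle f(x_{2n})\rangle<\langle g(x_{2n})\rangle$ and $\langle f(x_{2n+1})\rangle>\langle g(x_{2n+1})\rangle$ for each $n$. *)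

(* Defs.v *)
From HB Require Import structures.
From mathcomp Require Import all_boot all_order all_algebra finmap.
From mathcomp Require Import all_classical all_reals all_analysis.

Set Implicit Arguments.
Unset Strict Implicit.
Unset Printing Implicit Defensive.

Import Order.TTheory GRing.Theory Num.Theory.
Import numFieldNormedType.Exports.

Local Open Scope classical_set_scope.
Local Open Scope ring_scope.

(* Used as a type through the coercion [set_type], with the subtype topology;
   functions on [0,1] are then compared on [0,1] only. *)
Definition unitI (R : realType) : set R := `[0, 1].
Arguments unitI R : clear implicits.

Lemma unitI0_subproof (R : realType) : (0 : R) \in unitI R.
Proof. by rewrite inE /unitI /= in_itv /= lexx ler01. Qed.

Definition unitI0 (R : realType) : unitI R := exist _ 0 (unitI0_subproof R).

Section IC_dense.
Context {R : realType}.
Implicit Types (f g : unitI R -> R) (V : set (unitI R -> R)).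

Definition fracpart (x : R) : R := x - (Num.floor x)%:~R.

Definition cr f g : set (unitI R) :=
  [set x | fracpart (f x) = fracpart (g x)].

Definition supnorm f : R := sup (range (fun x => `|f x|)).

Definition dense_in_C V : Prop :=
  forall g, continuous g -> forall e : R, 0 < e ->
    exists2 f, V f & supnorm (f \- g) < e.

Definition monotone_to (u : nat -> unitI R) (x : unitI R) : Prop :=
  (nondecreasing_seq (set_val \o u) \/ nonincreasing_seq (set_val \o u)) /\
  u @ \oo --> x.

Definition alternates_at f g (x : unitI R) : Prop :=
  exists2 u : nat -> unitI R, monotone_to u x &
    forall n, fracpart (f (u (2 * n)%N)) < fracpart (g (u (2 * n)%N)) /\
              fracpart (f (u (2 * n).+1)) > fracpart (g (u (2 * n).+1)).

Record IC_dense V : Prop := {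
  IC_countable : countable V;
  IC_continuous : forall f, V f -> continuous f;
  IC_is_dense : dense_in_C V;
  IC_disjoint : forall f g f' g', V f -> V g -> V f' -> V g' ->
    f <> g -> f' <> g' -> [set f; g] <> [set f'; g'] ->
    cr f g `&` cr f' g' = set0;
  IC_endpoints : forall f g, V f -> V g -> f <> g ->
    forall x, cr f g x -> set_val x <> 0 /\ set_val x <> 1;
  IC_crossing : forall f g, V f -> V g -> f <> g ->
    forall x : unitI R, 0 < set_val x < 1 ->
      fracpart (f x) = fracpart (g x) -> alternates_at f g x
}.

End IC_dense.

Section probability.
Context {R : realType} {d : measure_display} {T : measurableType d}.
Context (P : probability T R).

(* Equality of laws is required on measurable sets only: on other sets both
   sides are junk values. [s] is the standard deviation and must be nonzero
   for [normal_prob m s] to be a Gaussian law. *)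
Definition has_normal_law (Y : T -> R) (m s : R) : Prop :=
  forall A : set R, measurable A -> P (Y @^-1` A) = normal_prob m s A.

Definition sigma_gen (J : Type) (Y : J -> T -> R) : set (set T) :=
  <<s \bigcup_(j in [set: J]) preimage_set_system setT (Y j) measurable >>.

Definition indep2 (F G : set (set T)) : Prop :=
  forall A B, F A -> G B -> P (A `&` B) = (P A * P B)%E.

Definition mutually_indep (K : choiceType) (F : K -> set (set T)) : Prop :=
  forall (J : {fset K}) (A : K -> set T), (forall j, j \in J -> F j (A j)) ->
    P (\bigcap_(j in [set` J]) A j) = (\prod_(j <- J) P (A j))%E.

Definition indep_rvs (K : choiceType) (Y : K -> T -> R) : Prop :=
  mutually_indep (fun k => sigma_gen (fun _ : unit => Y k)).

Definition indep_processes (K : choiceType) (J : Type) (Y : K -> J -> T -> R)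
  : Prop := mutually_indep (fun k => sigma_gen (Y k)).

(* The increment law at [s = unitI0] gives 'E(X t) = 0 and 'V(X t) = t.
   Independence of increments over a finite family of times is the case of an
   eventually constant sequence [t]. *)
Record standard_brownian_motion (X : unitI R -> T -> R) : Prop := {
  bm_start : forall w, X (unitI0 R) w = 0;
  bm_continuous : forall w, continuous (fun t => X t w);
  bm_increments : forall s t : unitI R, set_val s < set_val t ->
    has_normal_law (X t \- X s) 0 (Num.sqrt (set_val t - set_val s));
  bm_indep_increments : forall t : nat -> unitI R,
    nondecreasing_seq (set_val \o t) ->
    indep_rvs (fun i : nat => X (t i.+1) \- X (t i))
}.

End probability.

(* Main.v *)
Require Import Defs.
From HB Require Import structures.
From mathcomp Require Import all_boot all_order all_algebra finmap.
From mathcomp Require Import all_classical all_reals all_analysis.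
From mathcomp Require Import measurable_realfun.
From mathcomp Require Import ring lra zify.

(** On a uniform grid of mesh [1 / M] the paths [f_a = N_a + X_a] are sums of
    independent Gaussian variables, so each exceptional event is included in
    the limit inferior of events about grids, and only finite independence is
    used.

    Lattice points are not hit by [(c f_i - f_j, c' f_k - f_l)]: the expected
    occupation time of a box of radius [e] is of order [e ^ 2], but after a
    first visit it exceeds [e ^ 2] by a factor [log (1 / e)]. This gives
    disjointness of the crossing sets, and that at a crossing neither path has
    an integer value.

    If the fractional parts of [f] and [g] agree at [x] but do not alternate on
    either side of [x], then [f - g] stays on one side of an integer level up to
    the first grid time at which it reaches that level, and from then on its
    increments, independent of the past, are one-sided; this has probability 0
    because increments over geometric times dominate the earlier positions.

    For density, a Lipschitz target is followed with a positive probability,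
    uniform in the mesh, by steering each coarse increment against the sign of
    the current error; countably many minima of cones are dense. *)

Set Implicit Arguments.
Unset Strict Implicit.
Unset Printing Implicit Defensive.

Import Order.TTheory GRing.Theory Num.Theory.
Import numFieldNormedType.Exports.

Local Open Scope classical_set_scope.
Local Open Scope ring_scope.

(** * Events and real-valued probabilities *)

Section measurable_events.
Context {d : measure_display} {T : measurableType d} {R : realType}.
Implicit Types (f g : T -> R) (Q : T -> Prop).

(** The exceptional events quantify over all times and are not visibly measurable. Every estimate is
    therefore made on a fixed grid, with constants independent of the mesh, and a first grid index
    takes the place of a stopping time. The initial normal [N_a] gives each path a density of at
    most 1 at all times from 0 on, which makes the occupation bound uniform and settles the
    endpoints. The coefficients [c], [c'] let the planar estimate serve twice: with 1 it treats two
    differences, possibly with a common path [f_i = f_k], and with 0 the pair [(f_j, f_l)] at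
    integer points. The second use links fractional parts to levels: where neither path is an
    integer, both floors are locally constant, and the fractional parts differ by [f - g] minus a
    fixed integer. A difference that meets a level without oscillating on either side has, up to
    sign, a local minimum at that level or a single descent through it; rational left ends and
    lengths [2 / c] reduce these to countably many events. *)

Lemma measurable_le_event f g : measurable_fun setT f -> measurable_fun setT g ->
  measurable [set w | f w <= g w].
Proof.
move=> mf mg; rewrite -[X in measurable X]setTI.
exact: measurable_fun_le.
Qed.

Lemma measurable_lt_event f g : measurable_fun setT f -> measurable_fun setT g ->
  measurable [set w | f w < g w].
Proof.
move=> mf mg; rewrite -[X in measurable X]setTI -preimage_true.
exact: (measurable_fun_ltr mf mg measurableT).
Qed.

Lemma measurable_norm_le_event f (c : R) : measurable_fun setT f ->
  measurable [set w | `|f w| <= c].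
Proof.
by move=> mf; apply: measurable_le_event => //; exact: measurableT_comp.
Qed.

Lemma measurable_forall_event (Q : nat -> T -> Prop) :
  (forall i, measurable [set w | Q i w]) -> measurable [set w | forall i, Q i w].
Proof.
move=> mQ; rewrite (_ : [set w | _] = \bigcap_i [set w | Q i w]).
  exact: bigcap_measurableType.
by apply/seteqP; split=> w /= h i => [_|]; exact: h.
Qed.

Lemma measurable_exists_event (Q : nat -> T -> Prop) :
  (forall i, measurable [set w | Q i w]) -> measurable [set w | exists i, Q i w].
Proof.
move=> mQ; rewrite (_ : [set w | _] = \bigcup_i [set w | Q i w]).
  exact: bigcupT_measurable.
by apply/seteqP; split=> w /= [i]; exists i.
Qed.

Lemma measurable_imply_event (A : Prop) Q :
  (A -> measurable [set w | Q w]) -> measurable [set w | A -> Q w].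
Proof.
have [a|na] := pselect A => mQ.
  rewrite (_ : [set w | _] = [set w | Q w]); first exact: mQ.
  by apply/seteqP; split=> w /=; [apply|move=> ? _].
rewrite (_ : [set w | _] = setT); first exact: measurableT.
by apply/seteqP; split=> // w _ /na.
Qed.

Lemma measurable_cst_and_event (A : Prop) Q :
  (A -> measurable [set w | Q w]) -> measurable [set w | A /\ Q w].
Proof.
have [a|na] := pselect A => mQ.
  rewrite (_ : [set w | _] = [set w | Q w]); first exact: mQ.
  by apply/seteqP; split=> w /=; [case|].
rewrite (_ : [set w | _] = set0); first exact: measurable0.
by apply/seteqP; split=> // w /= [].
Qed.

Lemma measurable_and_event Q1 Q2 : measurable [set w | Q1 w] ->
  measurable [set w | Q2 w] -> measurable [set w | Q1 w /\ Q2 w].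
Proof. exact: measurableI. Qed.

Lemma measurable_not_event Q : measurable [set w | Q w] ->
  measurable [set w | ~ Q w].
Proof. exact: measurableC. Qed.

End measurable_events.

Section real_valued_probability.
Context {d : measure_display} {T : measurableType d} {R : realType}.
Variable P : probability T R.
Implicit Types A B : set T.

Definition prob A : R := fine (P A).

Lemma probE A : measurable A -> P A = (prob A)%:E.
Proof. by move=> mA; rewrite /prob fineK// fin_num_measure. Qed.

Lemma prob_ge0 A : 0 <= prob A.
Proof. by rewrite /prob fine_ge0. Qed.

Lemma prob_le A B : measurable A -> measurable B -> A `<=` B ->
  prob A <= prob B.
Proof.
move=> mA mB AB; rewrite -lee_fin -!probE//; apply: le_measure => //; exact/mem_set.
Qed.

Lemma prob_setT : prob setT = 1.
Proof. by rewrite /prob probability_setT. Qed.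

Lemma prob_le1 A : measurable A -> prob A <= 1.
Proof. by move=> mA; rewrite -prob_setT; apply: prob_le. Qed.

Lemma prob_setU A B : measurable A -> measurable B -> [disjoint A & B] ->
  prob (A `|` B) = prob A + prob B.
Proof.
move=> mA mB AB; apply: EFin_inj; rewrite EFinD -!probE//; last exact: measurableU.
by rewrite measureU//; apply/eqP; rewrite -disj_set2E.
Qed.

Lemma prob_setC A : measurable A -> prob (~` A) = 1 - prob A.
Proof.
move=> mA; apply: EFin_inj; rewrite -probE ?probability_setC//; last exact: measurableC.
by rewrite (probE mA).
Qed.

Lemma prob_setU_le A B : measurable A -> measurable B ->
  prob (A `|` B) <= prob A + prob B.
Proof.
move=> mA mB; rewrite -lee_fin EFinD -!probE//; last exact: measurableU.
exact: measureU2.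
Qed.

Lemma prob_cover_le n (A : nat -> set T) B : measurable B ->
  (forall i, measurable (A i)) ->
  (forall w, B w -> exists2 i, (i < n)%N & A i w) ->
  prob B <= \sum_(i < n) prob (A i).
Proof.
move=> mB mA BA.
have mU m : measurable (\big[setU/set0]_(i < m) A i) by apply: bigsetU_measurable.
apply: (@le_trans _ _ (prob (\big[setU/set0]_(i < n) A i))).
  apply: prob_le => // w /BA[i ni Ai]; rewrite -bigcup_mkord; by exists i.
elim: n {BA} => [|n IH]; first by rewrite !big_ord0 /prob measure0.
rewrite !big_ord_recr/=; apply: le_trans (prob_setU_le (mU _) (mA _)) _.
by rewrite lerD2r.
Qed.

Lemma prob_disjoint_le n (A : nat -> set T) B : measurable B ->
  (forall i, (i < n)%N -> measurable (A i)) ->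
  (forall i j w, (i < n)%N -> (j < n)%N -> A i w -> A j w -> i = j) ->
  (forall i w, (i < n)%N -> A i w -> B w) ->
  \sum_(i < n) prob (A i) <= prob B.
Proof.
move=> mB mA dA AB; rewrite -lee_fin -probE// -sumEFin.
rewrite (eq_bigr (fun i : 'I_n => P (A i))); last by move=> i _; rewrite probE//; exact: mA.
rewrite -(@measure_bigsetU_ord _ _ _ P n xpredT (fun i : 'I_n => A i)).
- apply: le_measure.
  + by apply/mem_set; apply: bigsetU_measurable => i _; exact: mA.
  + exact/mem_set.
  + move=> w; rewrite (big_morph (fun S : set T => S w) (id1 := False) (op1 := or)) //.
    elim/big_ind: _ => //.
      by move=> x y hx hy []; auto.
    by move=> i _; exact: AB.
- by move=> i; apply: mA.
- move=> i j _ _ [w [/= wi wj]]; apply/val_inj; exact: (dA _ _ w (ltn_ord i) (ltn_ord j)).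
Qed.

(** Law of total probability over the countably many values of [phi]; it serves as conditioning on a
    discretized variable. *)
Lemma prob_le_cells (phi : T -> int) (c : R) A B :
  0 <= c -> measurable A -> measurable B ->
  (forall z, measurable [set w | phi w = z]) ->
  (forall z, prob (A `&` [set w | phi w = z]) <=
             c * prob (B `&` [set w | phi w = z])) ->
  prob A <= c * prob B.
Proof.
move=> c0 mA mB mphi h.
(* Cells are numbered by [nat] through [pickle] so that a series can be summed; an [n] that codes no
   integer gives an empty cell. *)
pose C n := [set w | choice.pickle (phi w) = n].
have CE n : C n = set0 \/ exists z, C n = [set w | phi w = z].
  have [[z zn]|hn] := pselect (exists z : int, choice.pickle z = n).
    right; exists z; apply/seteqP; split=> w; rewrite /C/= -zn; last by move=> ->.
    exact: (pcan_inj choice.pickleK).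
  by left; apply/seteqP; split=> // w /= wn; apply: hn; exists (phi w).
have mC n : measurable (C n) by have [->|[z ->]] := CE n.
have tC D : trivIset setT (fun n => D `&` C n).
  by move=> i j _ _ [w [[_ wi] [_ wj]]]; rewrite -wi -wj.
have split D : measurable D -> P D = (\sum_(n <oo) P (D `&` C n))%E.
  move=> mD; rewrite -measure_semi_bigcup//.
  - congr (P _); apply/seteqP; split=> w; last by case=> n _ [].
    by move=> Dw; exists (choice.pickle (phi w)).
  - by move=> i; exact: measurableI.
  - by apply: bigcupT_measurable => i; exact: measurableI.
rewrite -lee_fin EFinM -!probE// (split A)// (split B)// -nneseriesZl//.
apply: lee_nneseries => // n _.
have [->|[z ->]] := CE n; first by rewrite !setI0 measure0 mule0.
have mI D : measurable D -> measurable (D `&` [set w | phi w = z]).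
  by move=> mD; apply: measurableI.
by rewrite (probE (mI _ mA)) (probE (mI _ mB)) -EFinM lee_fin.
Qed.

Lemma prob_ge_cells (phi : T -> int) (c : R) A B :
  0 <= c -> measurable A -> measurable B ->
  (forall z, measurable [set w | phi w = z]) ->
  (forall z, c * prob (B `&` [set w | phi w = z]) <=
             prob (A `&` [set w | phi w = z])) ->
  c * prob B <= prob A.
Proof.
rewrite le_eqVlt => /predU1P[<-|c0] mA mB mphi h; first by rewrite mul0r prob_ge0.
rewrite -ler_pdivlMl//; apply: (@prob_le_cells phi) => //.
  by rewrite invr_ge0 ltW.
by move=> z; rewrite ler_pdivlMl.
Qed.

(** The intersections of the tails of [E] increase, so continuity from below keeps their union at
    probability at most [e]; intersecting over [e = 1 / (k + 1)] gives a null cover. This is how an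
    event about all times is reached from grid events. *)
Lemma negligible_liminf B :
  (forall e : R, 0 < e -> exists E : nat -> set T,
    [/\ forall n, measurable (E n), forall n, prob (E n) <= e &
        forall w, B w -> exists n0, forall n, (n0 <= n)%N -> E n w]) ->
  P.-negligible B.
Proof.
move=> h.
have h' k : { E : nat -> set T |
    [/\ forall n, measurable (E n), forall n, prob (E n) <= (k.+1%:R)^-1 &
        forall w, B w -> exists n0, forall n, (n0 <= n)%N -> E n w]}.
  by apply: cid; apply: h; rewrite invr_gt0.
pose E k := sval (h' k).
pose F k n := \bigcap_(m in [set m | (n <= m)%N]) E k m.
have mE k n : measurable (E k n) by rewrite /E; case: (h' k) => ? [].
have mF k n : measurable (F k n) by apply: bigcap_measurable => //; exists n => /=.
have mU k : measurable (\bigcup_n F k n) by apply: bigcupT_measurable.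
have PU k : (P (\bigcup_n F k n) <= ((k.+1%:R)^-1)%:E)%E.
  have := @nondecreasing_cvg_mu _ _ _ P (F k) (mF k) (mU k).
  move=> /(_ _)/cvg_lim <-//.
    apply: lime_le; last first.
      apply: nearW => n /=; rewrite (probE (mF k n)) lee_fin.
      apply: (@le_trans _ _ (prob (E k n))); last by rewrite /E; case: (h' k) => ? [].
      by apply: prob_le => // w; apply => /=.
    apply: ereal_nondecreasing_is_cvgn => i j ij; apply: le_measure; rewrite ?inE//.
    by move=> w Fw m /= jm; apply: Fw => /=; exact: leq_trans jm.
  by move=> i j ij; apply/subsetPset => w Fw m /= jm; apply: Fw => /=; exact: leq_trans jm.
exists (\bigcap_k \bigcup_n F k n); split.
- exact: bigcap_measurableType.
- apply/eqP; rewrite eq_le measure_ge0 andbT.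
  apply/lee_addgt0Pr => e e0; rewrite add0e.
  have [k ke] : exists k : nat, (k.+1%:R)^-1 < e.
    exists (Num.truncn e^-1); rewrite invf_plt ?posrE//.
    by rewrite truncnS_gt.
  apply: le_trans (_ : P (\bigcup_n F k n) <= _)%E.
    apply: le_measure; rewrite ?inE//; first exact: bigcap_measurableType.
    by move=> w; apply.
  by apply: le_trans (PU k) _; rewrite lee_fin ltW.
- move=> w Bw k _; rewrite /F /E; case: (h' k) => E' [_ _ hE'] /=.
  by have [n0 hn] := hE' w Bw; exists n0.
Qed.

Lemma negligible_le B :
  (forall e : R, 0 < e -> exists E : set T,
    [/\ measurable E, prob E <= e & B `<=` E]) -> P.-negligible B.
Proof.
move=> h; apply: negligible_liminf => e /h[E [mE Ee BE]].
by exists (fun=> E); split=> // w /BE ?; exists 0%N.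
Qed.

Lemma negligible_exists_nat (Q : nat -> T -> Prop) :
  (forall n, P.-negligible [set w | Q n w]) ->
  P.-negligible [set w | exists n, Q n w].
Proof.
move=> h; apply: negligibleS (negligible_bigcup h).
by move=> w /= [n Qn]; exists n.
Qed.

Lemma negligible_exists (I : countType) (Q : I -> T -> Prop) :
  (forall i, P.-negligible [set w | Q i w]) ->
  P.-negligible [set w | exists i, Q i w].
Proof.
move=> h.
have : P.-negligible [set w | exists n, exists2 i, choice.unpickle n = Some i & Q i w].
  apply: negligible_exists_nat => n.
  case: (choice.unpickle n) => [i|].
    by apply: negligibleS (h i) => w /= [j [->]].
  by apply: negligibleS (negligible_set0 P) => w /= [].
apply: negligibleS => w [i Qi]; exists (choice.pickle i), i => //; exact: choice.pickleK.
Qed.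

Lemma negligible_imply (A : Prop) (Q : T -> Prop) :
  (A -> P.-negligible [set w | Q w]) -> P.-negligible [set w | A /\ Q w].
Proof.
have [a|na] := pselect A => h; first by apply: negligibleS (h a) => w [].
by apply: negligibleS (negligible_set0 P) => w [].
Qed.

End real_valued_probability.

(** * Independence of sub-sigma-algebras *)

Section independence.
Context {d : measure_display} {T : measurableType d} {R : realType}.
Variable P : probability T R.

(** The pi-lambda theorem with one event [A] frozen: the sets that factor against [A] form a Dynkin
    class. *)
Lemma indep_dynkin (A : set T) (G : set (set T)) :
  measurable A -> setI_closed G ->
  (forall B, G B -> measurable B /\ prob P (A `&` B) = prob P A * prob P B) ->
  forall B, <<s G >> B ->
    measurable B /\ prob P (A `&` B) = prob P A * prob P B.
Proof.
move=> mA IG GP B; rewrite -setI_closed_g_dynkin_g_sigma_algebra// => GB.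
pose L : set (set T) :=
  [set B | measurable B /\ prob P (A `&` B) = prob P A * prob P B].
apply: (GB L); split=> //; split.
- by split; [exact: measurableT|rewrite setIT prob_setT mulr1].
- move=> C [mC CP]; split; first exact: measurableC.
  rewrite prob_setC// mulrBr mulr1 -CP.
  have {2}-> : A = (A `&` ~` C) `|` (A `&` C) by rewrite -setIUr setUCl setIT.
  rewrite prob_setU ?addrK//.
  + by apply: measurableI => //; exact: measurableC.
  + exact: measurableI.
  + by apply/disj_setPS => w [[_ ?] [_ ?]].
- move=> F tF FP.
  have mF n : measurable (F n) by case: (FP n).
  have mU : measurable (\bigcup_n F n) by exact: bigcupT_measurable.
  split=> //; apply: EFin_inj; rewrite EFinM -!probE//; last exact: measurableI.
  rewrite setI_bigcupr !measure_semi_bigcup//.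
  + rewrite (probE P mA) -nneseriesZl//; apply: eq_eseriesr => n _.
    have mFn := mF n.
    transitivity ((prob P A)%:E * (prob P (F n))%:E)%E; last first.
      by congr (_ * _)%E; rewrite /prob fineK// fin_num_measure.
    have [_ FPn] := FP n; rewrite -EFinM -FPn /prob fineK// fin_num_measure//.
    exact: measurableI.
  + by move=> n; exact: measurableI.
  + by move=> i j _ _ [w [[_ wi] [_ wj]]]; apply: tF => //; exists w.
  + by apply: bigcupT_measurable => n; exact: measurableI.
Qed.

Variable xi : nat -> nat -> T -> R.
Hypothesis mxi : forall a i, measurable_fun setT (xi a i).

(** Rows are paths and columns time steps; one bound [n] serves both, and coordinates left free
    carry [setT]. *)
Definition box n (B : nat -> nat -> set R) : set T :=
  \bigcap_(a in `I_n) \bigcap_(i in `I_n) (xi a i @^-1` B a i).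

Definition box_indep : Prop :=
  forall n (B : nat -> nat -> set R), (forall a i, measurable (B a i)) ->
  prob P (box n B) = \prod_(a < n) \prod_(i < n) prob P (xi a i @^-1` B a i).

Hypothesis xi_indep : box_indep.

Definition gens (S : set (nat * nat)) : set (set T) :=
  \bigcup_(k in S) preimage_set_system setT (xi k.1 k.2) measurable.

(** [T] re-equipped with the sigma-algebra of the coordinates in [S]: depending only on these
    coordinates becomes ordinary measurability, and the lemmas on measurable events apply
    unchanged. *)
Definition sub_space (S : set (nat * nat)) := g_sigma_algebraType (gens S).

Definition boxes (S : set (nat * nat)) : set (set T) :=
  [set A | exists n B, [/\ forall a i, measurable (B a i),
    forall a i, ~ S (a, i) -> B a i = setT & A = box n B]].

Let measurable_xi a i (B : set R) : measurable B -> measurable (xi a i @^-1` B).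
Proof. by move=> mB; rewrite -[X in measurable X]setTI; exact: mxi. Qed.

Lemma measurable_box n B : (forall a i, measurable (B a i)) ->
  measurable (box n B).
Proof.
move=> mB; rewrite /box !bigcap_mkord; apply: bigsetI_measurable => a _.
by rewrite bigcap_mkord; apply: bigsetI_measurable => i _; exact: measurable_xi.
Qed.

(** Pads a box to a larger size with [setT], so that two boxes can be intersected coordinate by
    coordinate. *)
Let trunc n (B : nat -> nat -> set R) a i : set R :=
  if (a < n)%N && (i < n)%N then B a i else setT.

Let box_trunc n m B : (n <= m)%N -> box m (trunc n B) = box n B.
Proof.
move=> nm; apply/seteqP; split=> w h a /= an i /= jn.
  have /(_ (leq_trans jn nm)) := h a (leq_trans an nm) i.
  by rewrite /trunc an jn.
by rewrite /trunc; case: ifP => // /andP[an' jn']; exact: h.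
Qed.

Let measurable_trunc n B : (forall a i, measurable (B a i)) ->
  forall a i, measurable (trunc n B a i).
Proof. by move=> mB a i; rewrite /trunc; case: ifP. Qed.

Lemma boxes_setI_closed S : setI_closed (boxes S).
Proof.
move=> _ _ [n [B [mB SB ->]]] [m [C [mC SC ->]]].
exists (maxn n m), (fun a i => trunc n B a i `&` trunc m C a i); split.
- by move=> a i; apply: measurableI; exact: measurable_trunc.
- by move=> a i Sai; rewrite /trunc SB// SC//; do 2 case: ifP => _; rewrite setIT.
- rewrite -(@box_trunc n (maxn n m)) ?leq_maxl// -(@box_trunc m (maxn n m)) ?leq_maxr//.
  apply/seteqP; split=> w.
    by move=> [h1 h2] a an i jn; split; [exact: h1|exact: h2].
  by move=> h; split=> a an i jn; have [] := h a an i jn.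
Qed.

Lemma gens_boxes S : gens S `<=` boxes S.
Proof.
move=> A [[a i] /= Sai [B mB <-]]; rewrite setTI.
exists (maxn a i).+1, (fun b j => if (b == a) && (j == i) then B else setT); split.
- by move=> b j; case: ifP.
- by move=> b j Sbj; case: ifP => // /andP[/eqP ba /eqP ji]; case: Sbj; rewrite ba ji.
- apply/seteqP; split=> w.
    by move=> Bw b _ j _ /=; case: ifP => // /andP[/eqP-> /eqP->].
  move=> /(_ a) /= /(_ _ i) /=; rewrite !eqxx; apply.
    by rewrite ltnS leq_maxl.
  by rewrite ltnS leq_maxr.
Qed.

(** In each coordinate at least one of the two boxes is [setT], so the product over coordinates
    splits factor by factor. *)
Lemma indep_boxes S S' A B : S `&` S' = set0 -> boxes S A -> boxes S' B ->
  prob P (A `&` B) = prob P A * prob P B.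
Proof.
move=> SS' [n [B1 [mB1 SB1 ->]]] [m [B2 [mB2 SB2 ->]]].
set k := maxn n m.
rewrite -(@box_trunc n k) ?leq_maxl// -(@box_trunc m k) ?leq_maxr//.
set C1 := trunc n B1; set C2 := trunc m B2.
have mC1 a i : measurable (C1 a i) by exact: measurable_trunc.
have mC2 a i : measurable (C2 a i) by exact: measurable_trunc.
have -> : box k C1 `&` box k C2 = box k (fun a i => C1 a i `&` C2 a i).
  apply/seteqP; split=> w.
    by move=> [h1 h2] a an i jn; split; [exact: h1|exact: h2].
  by move=> h; split=> a an i jn; have [] := h a an i jn.
rewrite !xi_indep//; last by move=> a i; exact: measurableI.
rewrite -big_split/=; apply: eq_bigr => a _; rewrite -big_split/=.
apply: eq_bigr => i _.
have [Sai|nSai] := pselect (S (nat_of_ord a, nat_of_ord i)).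
  have -> : C2 a i = setT.
    rewrite /C2 /trunc SB2; first by case: ifP.
    by move=> S'ai; have : (S `&` S') (nat_of_ord a, nat_of_ord i) by []; rewrite SS'.
  by rewrite setIT preimage_setT prob_setT mulr1.
have -> : C1 a i = setT by rewrite /C1 /trunc SB1; first by case: ifP.
by rewrite setTI preimage_setT prob_setT mul1r.
Qed.

Let sub_boxes S A : <<s gens S >> A -> <<s boxes S >> A.
Proof. by apply: sub_sigma_algebra2; exact: gens_boxes. Qed.

Let measurable_boxes S A : boxes S A -> measurable A.
Proof. by move=> [n [B [mB _ ->]]]; exact: measurable_box. Qed.

Lemma sub_space_measurable S (A : set (sub_space S)) :
  measurable A -> measurable (A : set T).
Proof.
move=> /sub_boxes; apply: smallest_sub; first exact: sigma_algebra_measurable.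
exact: measurable_boxes.
Qed.

Lemma sub_space_measurable_fun S (f : T -> R) :
  measurable_fun (setT : set (sub_space S)) f -> measurable_fun setT f.
Proof.
move=> mf _ A mA; rewrite setTI; apply: (@sub_space_measurable S).
by rewrite -[X in measurable X]setTI; exact: mf.
Qed.

(** Two passes of the pi-lambda argument: first boxes of [S] against the sigma-algebra of [S'], then
    both sigma-algebras. *)
Lemma indep_sub_spaces S S' (A : set (sub_space S)) (B : set (sub_space S')) :
  S `&` S' = set0 -> measurable A -> measurable B ->
  prob P ((A : set T) `&` B) = prob P A * prob P B.
Proof.
move=> SS' mA mB.
have mB' : measurable (B : set T) by exact: sub_space_measurable mB.
have h C : boxes S C -> prob P (C `&` B) = prob P C * prob P B.
  move=> SC; apply: (proj2 (@indep_dynkin _ (boxes S') _ _ _ _ (sub_boxes mB))).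
  - exact: measurable_boxes SC.
  - exact: boxes_setI_closed.
  - by move=> D S'D; split; [exact: measurable_boxes S'D|exact: indep_boxes SC S'D].
rewrite setIC mulrC.
apply: (proj2 (@indep_dynkin _ (boxes S) _ _ _ _ (sub_boxes mA))) => //.
  exact: boxes_setI_closed.
by move=> D SD; split; [exact: measurable_boxes SD|rewrite setIC mulrC h].
Qed.

Lemma measurable_xi_sub_space S a i : S (a, i) ->
  measurable_fun (setT : set (sub_space S)) (xi a i).
Proof.
move=> Sai _ B mB; rewrite setTI; apply: sub_sigma_algebra.
by exists (a, i) => //; exists B => //; rewrite setTI.
Qed.

Lemma measurable_sum_sub_space S a m n :
  (forall i, (m <= i < n)%N -> S (a, i)) ->
  measurable_fun (setT : set (sub_space S)) (fun w => \sum_(m <= i < n) xi a i w).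
Proof.
move=> Sa.
pose h i (w : sub_space S) : R := if (m <= i < n)%N then xi a i w else 0.
have mh i : measurable_fun setT (h i).
  rewrite /h; case: (boolP (m <= i < n)%N) => [/Sa|_]; last exact: measurable_cst.
  exact: measurable_xi_sub_space.
rewrite (_ : (fun w => _) = fun w => \sum_(i <- index_iota m n) h i w).
  exact: measurable_sum.
apply/funext => w; rewrite big_seq [RHS]big_seq.
by apply: eq_bigr => i; rewrite mem_index_iota /h => ->.
Qed.

(** Discrete strong Markov property: [A i] decides from the coordinates in [S i] that the stopping
    index is [i], and [B i] is read off the independent coordinates in [S' i]. The probabilities of
    the disjoint [A i] add up to at most 1. *)
Lemma stopped_prob_le (S S' : nat -> set (nat * nat)) n (A B : nat -> set T)
    (E : set T) (c : R) :
  0 <= c -> measurable E ->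
  (forall i, (i < n)%N -> S i `&` S' i = set0) ->
  (forall i, (i < n)%N -> measurable (A i : set (sub_space (S i)))) ->
  (forall i, (i < n)%N -> measurable (B i : set (sub_space (S' i)))) ->
  (forall i j w, (i < n)%N -> (j < n)%N -> A i w -> A j w -> i = j) ->
  (forall i, (i < n)%N -> prob P (B i) <= c) ->
  (forall w, E w -> exists2 i, (i < n)%N & A i w /\ B i w) ->
  prob P E <= c.
Proof.
move=> c0 mE SS' mA mB dA Bc EAB.
have mA' i : (i < n)%N -> measurable (A i).
  by move=> /mA; exact: sub_space_measurable.
have mB' i : (i < n)%N -> measurable (B i).
  by move=> /mB; exact: sub_space_measurable.
pose C i := if (i < n)%N then A i `&` B i else set0.
have : prob P E <= \sum_(i < n) prob P (C i).
  apply: prob_cover_le => //.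
    by move=> i; rewrite /C; case: ifP => // ni; apply: measurableI; auto.
  by move=> w /EAB[i ni ABi]; exists i => //; rewrite /C ni.
move=> /le_trans; apply.
apply: (@le_trans _ _ (c * \sum_(i < n) prob P (A i))).
  rewrite mulr_sumr; apply: ler_sum => i _; rewrite /C ltn_ord.
  rewrite (@indep_sub_spaces (S i) (S' i)); [|exact: SS'|exact: mA|exact: mB].
  by rewrite mulrC ler_wpM2r ?prob_ge0// Bc.
rewrite ler_piMr// -(prob_setT P); exact: prob_disjoint_le.
Qed.

End independence.

(** * Gaussian bounds *)

Section gaussian_bounds.
Context {R : realType}.
Local Notation mu := lebesgue_measure.

Lemma normal_peakE (s : R) : 0 < s -> normal_peak s = normal_peak 1 / s.
Proof.
move=> s0; rewrite /normal_peak expr1n mul1r -mulrnAr sqrtrM ?sqr_ge0//.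
by rewrite sqrtr_sqr gtr0_norm// invfM mulrC.
Qed.

Lemma normal_peak_le (s : R) : 0 < s -> normal_peak s <= s^-1.
Proof.
move=> s0; rewrite normal_peakE//; apply: ler_piMl; first by rewrite invr_ge0 ltW.
rewrite /normal_peak expr1n mul1r invf_le1; last first.
  by rewrite sqrtr_gt0 mulrn_wgt0// pi_gt0.
rewrite -[X in X <= _]sqrtr1 ler_sqrt; last by rewrite mulrn_wge0// pi_ge0.
by have := pi_ge2 R; lra.
Qed.

Lemma normal_prob_itv_le (s a b : R) : 0 < s -> a <= b ->
  (normal_prob 0 s `[a, b] <= ((b - a) / s)%:E)%E.
Proof.
move=> s0 ab; rewrite /normal_prob.
have s0' : s != 0 by rewrite gt_eqF.
apply: (@le_trans _ _ (\int[mu]_(x in `[a, b]) (cst (s^-1)%:E x)))%E.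
  apply: ge0_le_integral => //=.
  - by move=> x _; rewrite lee_fin normal_pdf_ge0.
  - by apply/measurable_EFinP; apply: measurable_funTS; exact: measurable_normal_pdf.
  - by move=> x _; rewrite lee_fin (le_trans (normal_pdf_ub _ _ s0'))// normal_peak_le.
rewrite integral_cst//= lebesgue_measure_itv/= lte_fin.
case: ltP => [_|ba]; last by rewrite mule0 lee_fin divr_ge0 ?subr_ge0// ltW.
by rewrite -EFinB -EFinM mulrC.
Qed.

Lemma normal_pdf_ge (s r x : R) : 0 < s -> `|x| <= r ->
  normal_pdf 0 s r <= normal_pdf 0 s x.
Proof.
move=> s0 xr; have s0' : s != 0 by rewrite gt_eqF.
rewrite !normal_pdfE// ler_pM2l ?normal_peak_gt0//.
rewrite /normal_fun ler_expR !subr0 !mulNr lerN2 ler_pM2r; last first.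
  by rewrite invr_gt0 mulrn_wgt0// exprn_gt0.
by rewrite -(real_normK (num_real x)) ler_sqr ?nnegrE ?(le_trans _ xr).
Qed.

Lemma normal_prob_itv_ge (s r a b : R) : 0 < s -> a <= b -> - r <= a -> b <= r ->
  (((b - a) * normal_pdf 0 s r)%:E <= normal_prob 0 s `[a, b])%E.
Proof.
move=> s0 ab ra br; rewrite /normal_prob.
apply: (@le_trans _ _ (\int[mu]_(x in `[a, b]) (cst (normal_pdf 0 s r)%:E x)))%E.
  rewrite integral_cst//= lebesgue_measure_itv/= lte_fin.
  case: ltP => [_|ba]; first by rewrite -EFinB -EFinM mulrC.
  by have -> : b - a = 0; [lra|rewrite mul0r mule0].
apply: ge0_le_integral => //=.
- by move=> x _; rewrite lee_fin normal_pdf_ge0.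
- by apply/measurable_EFinP; apply: measurable_funTS; exact: measurable_normal_pdf.
- move=> x; rewrite in_itv/= lee_fin => /andP[ax xb]; apply: normal_pdf_ge => //.
  by rewrite ler_norml; lra.
Qed.

(** The standard normal density at 2. By scaling, [gauss_lower / s] bounds from below the density
    with deviation [s] on all of [[-2s, 2s]]. *)
Definition gauss_lower : R := normal_peak 1 * expR (- 2).

Lemma gauss_lower_gt0 : 0 < gauss_lower.
Proof. by rewrite mulr_gt0 ?expR_gt0// normal_peak_gt0. Qed.

Lemma gauss_lower_le1 : gauss_lower <= 1.
Proof.
rewrite -[X in _ <= X]mul1r ler_pM ?normal_peak_ge0 ?expR_ge0//.
by have := @normal_peak_le 1 ltr01; rewrite invr1.
Qed.

Lemma normal_pdf_2s (s : R) : 0 < s -> normal_pdf 0 s (s *+ 2) = gauss_lower / s.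
Proof.
move=> s0; rewrite normal_pdfE ?gt_eqF// normal_peakE// /normal_fun /gauss_lower.
have -> : - (s *+ 2 - 0) ^+ 2 / (s ^+ 2 *+ 2) = - 2.
  by have := s0; rewrite lt0r => /andP[s1 _]; field.
by rewrite mulrAC.
Qed.

(* On [x >= a] the Gaussian density is at most [2 s / a] times the exponential
   density of rate [a / (2 s^2)]. *)
Lemma normal_prob_tail (s a : R) : 0 < s -> 0 < a ->
  (normal_prob 0 s `[a, +oo[ <= (2 * s / a)%:E)%E.
Proof.
move=> s0 a0; rewrite /normal_prob.
pose l := a / (s ^+ 2 *+ 2).
have l0 : 0 < l by rewrite divr_gt0// mulrn_wgt0// exprn_gt0.
have c0 : 0 <= 2 * s / a by rewrite divr_ge0 ?mulr_ge0 ?ltW.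
have mexp : measurable_fun setT (EFin \o exponential_pdf l).
  by apply/measurable_EFinP; exact: measurable_exponential_pdf.
apply: (@le_trans _ _ (\int[mu]_(x in `[a, +oo[)
    ((2 * s / a)%:E * (exponential_pdf l x)%:E)))%E.
  apply: ge0_le_integral => //=.
  - by move=> x _; rewrite lee_fin normal_pdf_ge0.
  - by apply/measurable_EFinP; apply: measurable_funTS; exact: measurable_normal_pdf.
  - apply: emeasurable_funM; first exact: measurable_cst.
    exact: measurable_funTS mexp.
  - move=> x; rewrite in_itv/= andbT => ax.
    rewrite -EFinM lee_fin exponential_pdfE; last by rewrite (le_trans _ ax)// ltW.
    rewrite normal_pdfE ?gt_eqF// mulrA.
    have -> : 2 * s / a * l = s^-1.
      rewrite /l; have := s0; have := a0; rewrite !lt0r => /andP[? _] /andP[? _].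
      by field; apply/andP.
    apply: ler_pM; rewrite ?normal_peak_ge0 ?normal_fun_ge0 ?normal_peak_le//.
    rewrite /normal_fun ler_expR subr0 !mulNr lerN2 /l mulrAC.
    rewrite ler_pM2r ?invr_gt0 ?mulrn_wgt0 ?exprn_gt0//.
    by rewrite expr2 ler_pM2r//; lra.
rewrite ge0_integralZl//=; [|exact: measurable_funTS mexp|].
- rewrite -[leRHS]mule1; apply: lee_wpmul2l => //.
  rewrite -(integral_exponential_pdf l0); apply: ge0_subset_integral => //=.
  by move=> x _; rewrite lee_fin exponential_pdf_ge0// ltW.
- by move=> x _; rewrite lee_fin exponential_pdf_ge0// ltW.
Qed.

Lemma normal_prob_tailN (s a : R) : 0 < s -> 0 < a ->
  (normal_prob 0 s `]-oo, (- a)%R] <= (2 * s / a)%:E)%E.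
Proof.
move=> s0 a0; rewrite /normal_prob ge0_integration_by_substitutionNy.
- apply: le_trans (normal_prob_tail s0 a0); rewrite /normal_prob le_eqVlt.
  apply/orP; left; apply/eqP; apply: eq_integral => x _ /=.
  by rewrite !normal_pdfE ?gt_eqF// /normal_fun !subr0 sqrrN.
- by apply: continuous_subspaceT; apply: continuous_normal_pdf; rewrite gt_eqF.
- by move=> x _; exact: normal_pdf_ge0.
Qed.

Context {d : measure_display} {T : measurableType d} (P : probability T R).
Variables (Y : T -> R) (s : R).
Hypotheses (s0 : 0 < s) (Ylaw : has_normal_law P Y 0 s).

Let probY A : measurable A -> prob P [set w | A (Y w)] = fine (normal_prob 0 s A).
Proof. by move=> mA; rewrite /prob -(Ylaw mA). Qed.

Let fin_normal A : measurable A -> normal_prob 0 s A \is a fin_num.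
Proof. by move=> mA; rewrite fin_num_measure. Qed.

Lemma gauss_itv_le (a b : R) : a <= b ->
  prob P [set w | a <= Y w <= b] <= (b - a) / s.
Proof.
move=> ab; rewrite (_ : [set w | _] = [set w | `[a, b]%classic (Y w)]); last first.
  by apply/seteqP; split=> w /=; rewrite in_itv.
by rewrite probY// -lee_fin fineK ?fin_normal// normal_prob_itv_le.
Qed.

Lemma gauss_itv_pdf_ge (r a b : R) : a <= b -> - r <= a -> b <= r ->
  (b - a) * normal_pdf 0 s r <= prob P [set w | a <= Y w <= b].
Proof.
move=> ab ra br; rewrite (_ : [set w | _] = [set w | `[a, b]%classic (Y w)]); last first.
  by apply/seteqP; split=> w /=; rewrite in_itv.
by rewrite probY// -lee_fin fineK ?fin_normal// normal_prob_itv_ge.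
Qed.

Lemma gauss_itv_ge (a b : R) : a <= b -> - (2 * s) <= a -> b <= 2 * s ->
  gauss_lower * ((b - a) / s) <= prob P [set w | a <= Y w <= b].
Proof.
move=> ab ra br; rewrite mulrCA -normal_pdf_2s//.
by apply: gauss_itv_pdf_ge => //; rewrite mulr2n; lra.
Qed.

Hypothesis mY : measurable_fun setT Y.

(** The two tails contribute [2 * s / a] each. Linear decay in [s / a] is all that the later choices
    of scale rely on. *)
Lemma gauss_tail (a : R) : 0 < a -> prob P [set w | a < `|Y w|] <= 4 * s / a.
Proof.
move=> a0.
have h (A : set R) : measurable A -> (normal_prob 0 s A <= (2 * s / a)%:E)%E ->
    prob P [set w | A (Y w)] <= 2 * s / a.
  by move=> mA hA; rewrite probY// -lee_fin fineK ?fin_normal.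
have h1 := h `[a, +oo[%classic (measurable_itv _) (normal_prob_tail s0 a0).
have h2 := h `]-oo, (- a)%R]%classic (measurable_itv _) (normal_prob_tailN s0 a0).
have mA (A : set R) : measurable A -> measurable [set w | A (Y w)].
  by move=> mA; rewrite -[X in measurable X]setTI; exact: mY.
have mA1 := mA `[a, +oo[%classic (measurable_itv _).
have mA2 := mA `]-oo, (- a)%R]%classic (measurable_itv _).
have := prob_setU_le P mA1 mA2.
have : prob P [set w | a < `|Y w|] <=
    prob P ([set w | `[a, +oo[%classic (Y w)] `|` [set w | `]-oo, (- a)%R]%classic (Y w)]).
  apply: prob_le.
  - apply: measurable_lt_event => //; exact: measurableT_comp.
  - exact: measurableU.
  - move=> w /=; rewrite !in_itv/= andbT lter_normr => /orP[/ltW|]; first by left.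
    by rewrite ltrNr => /ltW; right.
lra.
Qed.

End gaussian_bounds.

(** * Brownian paths on grids *)

Section clip.
Context {R : realType}.

Lemma clip_subproof (x : R) : Num.max 0 (Num.min x 1) \in unitI R.
Proof.
by rewrite inE /unitI /= in_itv /= le_max lexx/= ge_max ler01/= ge_min lexx orbT.
Qed.

(** Retraction of the line onto [[0, 1]]: composed with it, paths become functions of a real time,
    constant outside the interval. *)
Definition clip (x : R) : unitI R := exist _ (Num.max 0 (Num.min x 1)) (clip_subproof x).

Lemma clipE (x : R) : 0 <= x <= 1 -> set_val (clip x) = x.
Proof.
by move=> /andP[x0 x1]; rewrite set_valE/= (min_idPl x1) (max_idPr x0).
Qed.

Lemma unitI_itv (t : unitI R) : 0 <= set_val t <= 1.
Proof.
by have := set_valP t; rewrite /unitI /= in_itv.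
Qed.

Lemma clipK (t : unitI R) : clip (set_val t) = t.
Proof. by apply: val_inj; exact: (clipE (unitI_itv t)). Qed.

Lemma clip0 : clip 0 = unitI0 R.
Proof. by apply: val_inj => /=; rewrite (min_idPl ler01) maxxx. Qed.

Lemma continuous_clip : continuous clip.
Proof.
apply: continuous_comp_initial => x.
apply: (@continuous_max _ R (fun=> 0) (fun x => Num.min x 1)).
  exact: cst_continuous.
by apply: continuous_min; [exact: cvg_id|exact: cst_continuous].
Qed.

Lemma clip_nondecreasing (x y : R) : x <= y -> set_val (clip x) <= set_val (clip y).
Proof.
move=> xy; rewrite !set_valE/= ge_max le_max lexx/= le_max le_min !ge_min.
by rewrite xy lexx !orbT.
Qed.

End clip.

Lemma continuous_distP (R : realType) (f : R -> R) (x e : R) :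
  continuous f -> 0 < e ->
  exists2 dl : R, 0 < dl & forall y : R, `|x - y| < dl -> `|f y - f x| <= e.
Proof.
move=> cf e0; have /cvgrPdist_le/(_ _ e0)[dl /= dl0 h] := cf x.
by exists dl => // y /h; rewrite distrC.
Qed.

Section generated.
Context {d : measure_display} {T : measurableType d} {R : realType}.
Variable P : probability T R.

Lemma mutually_indep_nat (F : nat -> set (set T)) : mutually_indep P F ->
  forall n A, (forall a, F a (A a)) ->
  P (\bigcap_(a in `I_n) A a) = (\prod_(a < n) P (A a))%E.
Proof.
move=> FP n A FA; pose J := [fset a in iota 0 n]%fset.
have JE a : (a \in J) = (a < n)%N by rewrite inE/= mem_iota.
have -> : \bigcap_(a in `I_n) A a = \bigcap_(a in [set` J]) A a.
  by apply/seteqP; split=> w h a /= an; apply: h => /=; move: an; rewrite JE.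
rewrite FP; last by move=> a _; exact: FA.
rewrite -(big_mkord xpredT (fun a => P (A a))); apply: perm_big.
apply: uniq_perm; [exact: fset_uniq|exact: iota_uniq|].
by move=> a; rewrite JE mem_index_iota.
Qed.

Variables (J : Type) (Y : J -> T -> R).

Definition gen_space := g_sigma_algebraType
  (\bigcup_(j in [set: J]) preimage_set_system setT (Y j) measurable).

Lemma measurable_gen_space j : measurable_fun (setT : set gen_space) (Y j).
Proof.
move=> _ B mB; rewrite setTI; apply: sub_sigma_algebra.
by exists j => //; exists B => //; rewrite setTI.
Qed.

Lemma sigma_gen_preimage (f : T -> R) B :
  measurable_fun (setT : set gen_space) f -> measurable B ->
  measurable (f @^-1` B : set gen_space).
Proof. by move=> mf mB; rewrite -[X in measurable X]setTI; exact: mf. Qed.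

End generated.

Section process.
Context {R : realType} {d : measure_display} {T : measurableType d}.
Variable P : probability T R.
Variables (N : nat -> {RV P >-> R}) (X : nat -> unitI R -> {RV P >-> R}).

Definition path a (x : R) (w : T) : R := N a w + X a (clip x) w.

Definition grid_time (M i : nat) : unitI R := clip (i%:R / M%:R).

(** Index 0 holds the initial value and index [i + 1] the increment ending at grid time [i + 1].
    Hence the path at grid index [j] is the sum of the terms [0, ..., j]. *)
Definition grid_incr M a i : T -> R :=
  if i is i'.+1 then X a (grid_time M i'.+1) \- X a (grid_time M i') else N a.

Hypotheses (N_indep : indep_rvs P (fun n : nat => (N n : T -> R)))
  (X_brownian : forall n, standard_brownian_motion P (fun t => (X n t : T -> R)))
  (X_indep : indep_processes P (fun (n : nat) t => (X n t : T -> R)))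
  (NX_indep : indep2 P
     (sigma_gen (fun n : nat => (N n : T -> R)))
     (sigma_gen (fun nt : nat * unitI R => (X nt.1 nt.2 : T -> R)))).

Lemma measurable_grid_incr M a i : measurable_fun setT (grid_incr M a i).
Proof. by case: i => [|i] //=; apply: measurable_funB. Qed.

Lemma measurable_path a x : measurable_fun setT (path a x).
Proof. exact: measurable_funD. Qed.

Lemma continuous_path a w : continuous (fun x => path a x w).
Proof.
move=> x; have h : {for x, continuous (fun x => X a (clip x) w)}.
  apply: (@continuous_comp _ _ _ clip (fun t => X a t w) x).
    exact: continuous_clip.
  exact: (bm_continuous (X_brownian a)).
exact: cvgD (cvg_cst _) h.
Qed.

Lemma grid_pathE M a j w :
  path a (j%:R / M%:R) w = \sum_(0 <= i < j.+1) grid_incr M a i w.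
Proof.
rewrite big_nat_recl// /path; congr (_ + _).
elim: j => [|j IH].
  by rewrite big_geq// mul0r clip0 (bm_start (X_brownian a)).
by rewrite big_nat_recr//= -IH /grid_time addrC subrK.
Qed.

Lemma grid_path_incrE M a j k w : (j <= k)%N ->
  path a (k%:R / M%:R) w - path a (j%:R / M%:R) w =
  \sum_(j.+1 <= i < k.+1) grid_incr M a i w.
Proof.
move=> jk; rewrite !grid_pathE (@big_cat_nat _ _ _ j.+1 _ k.+1)//=.
by rewrite addrAC subrr add0r.
Qed.

Lemma grid_time_val M i : (i <= M)%N -> set_val (grid_time M i) = i%:R / M%:R.
Proof.
case: M => [|M]; last first.
  move=> iM; apply: clipE; rewrite divr_ge0//= ler_pdivrMr ?ltr0n//.
  by rewrite mul1r ler_nat.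
by rewrite leqn0 => /eqP->; rewrite /grid_time mul0r clipE// lexx ler01.
Qed.

Lemma grid_path_law M a j k : (j < k)%N -> (k <= M)%N ->
  has_normal_law P (fun w => path a (k%:R / M%:R) w - path a (j%:R / M%:R) w) 0
    (Num.sqrt ((k - j)%:R / M%:R)).
Proof.
move=> jk kM.
have M0 : (0 : R) < M%:R by rewrite ltr0n; lia.
have jM : (j <= M)%N by lia.
have lt : set_val (grid_time M j) < set_val (grid_time M k).
  by rewrite !grid_time_val// ltr_pM2r ?invr_gt0// ltr_nat.
have tE : (k - j)%:R / M%:R = set_val (grid_time M k) - set_val (grid_time M j).
  by rewrite (grid_time_val kM) (grid_time_val jM) -mulrBl natrB// ltnW.
rewrite tE; have := bm_increments (X_brownian a) lt.
rewrite (_ : (fun w => _) = X a (grid_time M k) \- X a (grid_time M j))//.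
by apply/funext => w /=; rewrite /path /grid_time; ring.
Qed.

Let bigcap_gen (J : Type) (Y : J -> T -> R) n (A : nat -> set T) :
  (forall a, sigma_gen Y (A a)) -> sigma_gen Y (\bigcap_(a in `I_n) A a).
Proof.
move=> YA; rewrite bigcap_mkord.
have : measurable (\big[setI/setT]_(i < n) A i : set (gen_space Y)).
  by apply: bigsetI_measurable => i _; exact: YA.
by [].
Qed.

(** The hypotheses act from the outside in: [NX_indep] separates column 0 from the rest, [N_indep]
    and [X_indep] separate the rows, and independence of increments splits each row. *)
Lemma grid_box_indep M : box_indep P (grid_incr M).
Proof.
move=> [|n] B mB.
  rewrite big_ord0 (_ : box _ _ _ = setT) ?prob_setT//.
  by apply/seteqP; split=> // w _ a.
pose A a := N a @^-1` B a 0%N.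
pose C a i := (X a (grid_time M i.+1) \- X a (grid_time M i)) @^-1` B a i.+1.
have bE : box (grid_incr M) n.+1 B =
    (\bigcap_(a in `I_n.+1) A a) `&`
    (\bigcap_(a in `I_n.+1) \bigcap_(i in `I_n) C a i).
  apply/seteqP; split=> w.
    move=> h; split=> a /= an; first exact: (h a an 0%N).
    by move=> i /= jn; apply: (h a an i.+1).
  by move=> [h1 h2] a /= an [|i] /= jn; [exact: h1|exact: h2].
have mX a t : measurable_fun
    (setT : set (gen_space (fun nt : nat * unitI R => (X nt.1 nt.2 : T -> R)))) (X a t).
  exact: (@measurable_gen_space _ _ _ _
    (fun nt : nat * unitI R => (X nt.1 nt.2 : T -> R)) (a, t)).
have PbE : P (box (grid_incr M) n.+1 B) =
    (\prod_(a < n.+1) (P (A a) * \prod_(i < n) P (C a i)))%E.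
  rewrite bE NX_indep; last 2 first.
  - apply: bigcap_gen => a.
    apply: sigma_gen_preimage (mB _ _).
    exact: (@measurable_gen_space _ _ _ _ (fun n : nat => (N n : T -> R)) a).
  - apply: bigcap_gen => a; apply: bigcap_gen => i.
    apply: sigma_gen_preimage (mB _ _).
    by apply: measurable_funB; exact: mX.
  rewrite big_split/=; congr (_ * _)%E.
    apply: (mutually_indep_nat N_indep) => a; apply: sigma_gen_preimage (mB _ _).
    exact: (@measurable_gen_space _ _ _ _ (fun _ : unit => (N a : T -> R)) tt).
  rewrite (mutually_indep_nat X_indep); last first.
    move=> a; apply: bigcap_gen => i; apply: sigma_gen_preimage (mB _ _).
    by apply: measurable_funB;
      exact: (@measurable_gen_space _ _ _ _ (fun t => (X a t : T -> R))).
  apply: eq_bigr => a _.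
  have nd : nondecreasing_seq (set_val \o grid_time M).
    move=> i j ij /=; apply: clip_nondecreasing.
    by rewrite ler_wpM2r ?invr_ge0// ler_nat.
  apply: (mutually_indep_nat (bm_indep_increments (X_brownian a) nd)) => i.
  apply: sigma_gen_preimage (mB _ _).
  exact: (@measurable_gen_space _ _ _ _
    (fun _ : unit => X a (grid_time M i.+1) \- X a (grid_time M i)) tt).
have mP a i : measurable (grid_incr M a i @^-1` B a i).
  by rewrite -[X in measurable X]setTI; exact: measurable_grid_incr.
have mb : measurable (box (grid_incr M) n.+1 B).
  by apply: measurable_box => // a i; exact: measurable_grid_incr.
apply: EFin_inj; rewrite -probE// PbE -prodEFin; apply: eq_bigr => a _.
rewrite big_ord_recl EFinM -probE//; congr (_ * _)%E.
by rewrite -prodEFin; apply: eq_bigr => i _; rewrite -probE.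
Qed.

End process.

(** * Landing near an independent random target *)

Section cells.
Context {d : measure_display} {T : measurableType d} {R : realType}.
Variable P : probability T R.
Variable xi : nat -> nat -> T -> R.
Hypothesis mxi : forall a i, measurable_fun setT (xi a i).
Hypothesis xi_indep : box_indep P xi.
Variables (S S' : set (nat * nat)).
Hypothesis SS' : S `&` S' = set0.
Variables (Y G : T -> R) (B : set T) (e : R).
Hypotheses (e0 : 0 < e)
  (mY : measurable_fun (setT : set (sub_space xi S)) Y)
  (mG : measurable_fun (setT : set (sub_space xi S')) G)
  (mB : measurable (B : set (sub_space xi S'))).

Let cell w := Num.floor (G w / e).

Let cellE z : [set w | cell w = z] =
  [set w | z%:~R * e <= G w] `&` [set w | G w < (z + 1)%:~R * e].
Proof.
apply/seteqP; split=> w; rewrite /cell /=.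
  by move=> <-; rewrite -ler_pdivlMr// -ltr_pdivrMr// ge_floor floorD1_gt.
by move=> [h1 h2]; apply: floor_def; rewrite ler_pdivlMr// ltr_pdivrMr// h1.
Qed.

Let cellP z w : cell w = z -> z%:~R * e <= G w /\ G w < (z + 1)%:~R * e.
Proof. by move=> wz; have : [set w | cell w = z] w by []; rewrite cellE. Qed.

Let mcell z : measurable ([set w | cell w = z] : set (sub_space xi S')).
Proof.
rewrite cellE; apply: measurableI.
  by apply: measurable_le_event => //; exact: measurable_cst.
by apply: measurable_lt_event => //; exact: measurable_cst.
Qed.

Let mYitv a b : measurable ([set w | a <= Y w <= b] : set (sub_space xi S)).
Proof.
rewrite (_ : [set w | _] = [set w | a <= Y w] `&` [set w | Y w <= b]).
  by apply: measurableI; apply: measurable_le_event => //; exact: measurable_cst.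
by apply/seteqP; split=> w /=; [move=> /andP|move=> [-> ->]].
Qed.

Let mT (U : set (nat * nat)) (A : set T) :
  measurable (A : set (sub_space xi U)) -> measurable A.
Proof. exact: sub_space_measurable. Qed.

Let mnear : measurable [set w | `|Y w - G w| <= e].
Proof.
apply: measurable_norm_le_event; apply: measurable_funB.
  exact: sub_space_measurable_fun mY.
exact: sub_space_measurable_fun mG.
Qed.

(** Once [G] is known up to a cell of length [e], the event forces [Y] into that cell enlarged by
    [e] on both sides, an interval of length [3 * e]. Independence of [Y] from the cell turns the
    interval bound into a factor. *)
Lemma prob_near_le (C : R) : 0 <= C ->
  (forall a b, a <= b -> prob P [set w | a <= Y w <= b] <= C * (b - a)) ->
  prob P (B `&` [set w | `|Y w - G w| <= e]) <= C * (3 * e) * prob P B.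
Proof.
move=> C0 hC; apply: (@prob_le_cells _ _ _ P cell).
- by rewrite !mulr_ge0// ltW.
- by apply: measurableI => //; exact: mT mB.
- exact: mT mB.
- by move=> z; apply: mT (mcell z).
move=> z; set D := B `&` [set w | cell w = z].
have mD : measurable (D : set (sub_space xi S')) by exact: measurableI.
pose I := [set w | (z - 1)%:~R * e <= Y w <= (z + 2)%:~R * e].
apply: (@le_trans _ _ (prob P (I `&` D))).
  apply: prob_le.
  - apply: measurableI; last exact: mT (mcell z).
    by apply: measurableI => //; exact: mT mB.
  - by apply: measurableI; [exact: mT (mYitv _ _)|exact: mT mD].
  - move=> w [[Bw /= near] cw]; have [h1 h2] := cellP cw.
    split; last by split.
    move: near; rewrite /I /= ler_norml => /andP[n1 n2].
    by move: h1 h2; rewrite !intrD !intrN/= => h1 h2; apply/andP; split; lra.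
rewrite (indep_sub_spaces mxi xi_indep SS' (mYitv _ _) mD).
rewrite ler_wpM2r ?prob_ge0//; apply: le_trans (hC _ _ _) _.
  by rewrite ler_pM2r// ler_int; lia.
by rewrite ler_wpM2l// -mulrBl -rmorphB/= (_ : z + 2 - (z - 1) = 3) //; ring.
Qed.

(** If [Y] falls into the cell of [G], their distance is at most [e]. The bounds [|G| <= r] and
    [e <= r] keep that cell inside [[-2r, 2r]], where the lower bound for [Y] is available. *)
Lemma prob_near_ge (c r : R) : 0 <= c -> e <= r ->
  (forall w, B w -> `|G w| <= r) ->
  (forall a, - (2 * r) <= a -> a + e <= 2 * r ->
     c <= prob P [set w | a <= Y w <= a + e]) ->
  c * prob P B <= prob P (B `&` [set w | `|Y w - G w| <= e]).
Proof.
move=> c0 er BG hc; apply: (@prob_ge_cells _ _ _ P cell) => //.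
- by apply: measurableI => //; exact: mT mB.
- exact: mT mB.
- by move=> z; apply: mT (mcell z).
move=> z; set D := B `&` [set w | cell w = z].
have mD : measurable (D : set (sub_space xi S')) by exact: measurableI.
have [->|/set0P[w0 [Bw0 /cellP[z1 z2]]]] := eqVneq D set0.
  by rewrite /prob measure0 mulr0 prob_ge0.
have := BG _ Bw0; rewrite ler_norml => /andP[g1 g2].
move: z2; rewrite intrD mulrDl mul1r => z2.
pose I := [set w | z%:~R * e <= Y w <= z%:~R * e + e].
apply: (@le_trans _ _ (prob P (I `&` D))).
  rewrite (indep_sub_spaces mxi xi_indep SS' (mYitv _ _) mD).
  by rewrite ler_wpM2r ?prob_ge0//; apply: hc; lra.
apply: prob_le.
- by apply: measurableI; [exact: mT (mYitv _ _)|exact: mT mD].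
- apply: measurableI; last exact: mT (mcell z).
  by apply: measurableI => //; exact: mT mB.
- move=> w [/= Iw [Bw cw]]; split=> //; split=> //=.
  have [h1] := cellP cw; rewrite intrD mulrDl mul1r => h2; move: Iw => /andP[i1 i2].
  by rewrite ler_norml; apply/andP; split; lra.
Qed.

End cells.

(** * Planar Brownian motion misses points *)

(** Coordinates of all paths up to grid index [j]; the initial values, at index 0, always belong to
    the past. *)
Definition past j : set (nat * nat) := [set x | (x.2 <= j)%N].

Definition future j : set (nat * nat) := [set x | (j < x.2)%N].

Lemma past_future j : past j `&` future j = set0.
Proof. by apply/seteqP; split=> // -[a b] []; rewrite /past /future /= leqNgt => /negP. Qed.

Lemma ex_first (Q : nat -> Prop) : (exists m, Q m) ->
  exists2 m, Q m & forall m', (m' < m)%N -> ~ Q m'.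
Proof.
move=> [m Qm]; have exQ : exists m, `[< Q m >] by exists m; exact/asboolP.
case: (ex_minnP exQ) => m0 /asboolP Qm0 min0; exists m0 => // m' m'm0 /asboolP/min0.
by rewrite leqNgt m'm0.
Qed.

(** Each dyadic block from [n * 2 ^ k] to [n * 2 ^ k.+1] contributes at least [n / 2]. This is the
    logarithm of the planar argument. *)
Lemma harmonic_ge (R : realType) n k : (0 < n)%N ->
  (n * k)%:R / 2 <= \sum_(n <= t < n * 2 ^ k) (n%:R / t%:R) :> R.
Proof.
move=> n0; elim: k => [|k IH].
  by rewrite muln0 mul0r muln1 big_geq.
have le1 : (n <= n * 2 ^ k)%N by rewrite leq_pmulr// expn_gt0.
have le2 : (n * 2 ^ k <= n * 2 ^ k.+1)%N by rewrite leq_mul2l leq_exp2l// leqnSn orbT.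
rewrite (big_cat_nat le1 le2)/= mulnS natrD mulrDl addrC; apply: lerD => //.
have -> : n%:R / 2 = \sum_(n * 2 ^ k <= t < n * 2 ^ k.+1) (2 ^+ k.+1)^-1 :> R.
  rewrite sumr_const_nat expnS mulnCA mul2n -addnn addnK -[RHS]mulr_natr.
  rewrite natrM natrX exprS.
  have h2 : (2 : R) ^+ k != 0 by rewrite expf_neq0.
  by field.
apply: ler_sum_nat => t /andP[t1 t2].
have t0 : (0 < t)%N by apply: leq_trans t1; rewrite muln_gt0 n0 expn_gt0.
rewrite ler_pdivlMr ?ltr0n// mulrC ler_pdivrMr ?exprn_gt0//.
by rewrite -natrX -natrM ler_nat ltnW.
Qed.

Section planar.
Context {R : realType} {d : measure_display} {T : measurableType d}.
Variable P : probability T R.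
Variables (N : nat -> {RV P >-> R}) (X : nat -> unitI R -> {RV P >-> R}).
Hypotheses (N_normal : forall n, has_normal_law P (N n) 0 1)
  (N_indep : indep_rvs P (fun n : nat => (N n : T -> R)))
  (X_brownian : forall n, standard_brownian_motion P (fun t => (X n t : T -> R)))
  (X_indep : indep_processes P (fun (n : nat) t => (X n t : T -> R)))
  (NX_indep : indep2 P
     (sigma_gen (fun n : nat => (N n : T -> R)))
     (sigma_gen (fun nt : nat * unitI R => (X nt.1 nt.2 : T -> R)))).

Local Notation path := (path N X).
Local Notation xi := (grid_incr N X).
Let xi_indep M : box_indep P (xi M).
Proof. exact: grid_box_indep. Qed.

Let mxi M a b : measurable_fun setT (xi M a b).
Proof. exact: measurable_grid_incr. Qed.

Lemma measurable_grid_path S M a j : (forall i, (i <= j)%N -> S (a, i)) ->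
  measurable_fun (setT : set (sub_space (xi M) S)) (path a (j%:R / M%:R)).
Proof.
move=> Sa; rewrite (_ : path a _ = fun w => \sum_(0 <= i < j.+1) xi M a i w).
  by apply: measurable_sum_sub_space => i; rewrite ltnS => /andP[_ /Sa].
by apply/funext => w; rewrite grid_pathE.
Qed.

Lemma measurable_grid_path_incr S M a j k : (j <= k)%N ->
  (forall i, (j < i <= k)%N -> S (a, i)) ->
  measurable_fun (setT : set (sub_space (xi M) S))
    (fun w => path a (k%:R / M%:R) w - path a (j%:R / M%:R) w).
Proof.
move=> jk Sa; rewrite (_ : (fun w => _) = fun w => \sum_(j.+1 <= i < k.+1) xi M a i w).
  by apply: measurable_sum_sub_space => i; rewrite ltnS => /Sa.
by apply/funext => w; rewrite grid_path_incrE.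
Qed.

Lemma path0_law M a : has_normal_law P (path a (0%:R / M%:R)) 0 1.
Proof.
rewrite (_ : path a _ = N a); first exact: N_normal.
by apply/funext => w; rewrite /path mul0r clip0 (bm_start (X_brownian a)) addr0.
Qed.

(** The randomness comes from [N_a] alone, whose density is at most 1; the increment of the path up
    to time [m / M] is moved into the target. So the bound is the same at all times, time 0
    included. *)
Lemma grid_near_le M m a (G : T -> R) (B : set T) (e : R) : 0 < e ->
  measurable_fun (setT : set (sub_space (xi M) [set k | k.1 <> a])) G ->
  measurable (B : set (sub_space (xi M) [set k | k.1 <> a])) ->
  prob P (B `&` [set w | `|G w - path a (m%:R / M%:R) w| <= e]) <= 3 * e * prob P B.
Proof.
move=> e0 mG mB.
pose S : set (nat * nat) := [set (a, 0%N)].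
pose S' : set (nat * nat) := [set k | k <> (a, 0%N)].
have sub : [set k : nat * nat | k.1 <> a] `<=` S' by move=> [b j] /= h [].
have SS' : S `&` S' = set0 by apply/seteqP; split=> // k [].
pose Y w := path a (0%:R / M%:R) w.
pose G' w := G w - (path a (m%:R / M%:R) w - path a (0%:R / M%:R) w).
have subg : gens (xi M) [set k | k.1 <> a] `<=` gens (xi M) S'.
  by apply: bigcup_subset.
have mY : measurable_fun (setT : set (sub_space (xi M) S)) Y.
  by apply: measurable_grid_path => i; rewrite leqn0 => /eqP->.
have mG' : measurable_fun (setT : set (sub_space (xi M) S')) G'.
  apply: measurable_funB.
    by move=> _ A mA; apply: sub_sigma_algebra2 subg _ _; exact: mG.
  by apply: measurable_grid_path_incr => // i /andP[i0 _] [] i0'; rewrite i0' in i0.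
have mB' : measurable (B : set (sub_space (xi M) S')).
  by apply: sub_sigma_algebra2 subg _ _; exact: mB.
have := @prob_near_le _ _ _ P (xi M) (@mxi M) (@xi_indep M) S S' SS' Y G' B e e0
  mY mG' mB' 1 ler01.
rewrite mul1r (_ : [set w | `|Y w - G' w| <= e] =
    [set w | `|G w - path a (m%:R / M%:R) w| <= e]).
  apply=> x y xy; rewrite mul1r -[leRHS]divr1.
  by apply: gauss_itv_le => //; exact: path0_law.
apply/seteqP; split=> w /=;
  rewrite (_ : Y w - G' w = - (G w - path a (m%:R / M%:R) w)) ?normrN//;
  by rewrite /Y /G'; ring.
Qed.

Lemma increment_near_ge M j m a (G : T -> R) (B : set T) (e s : R) :
  (0 < m)%N -> (j + m <= M)%N -> s = Num.sqrt (m%:R / M%:R) -> 0 < e -> e <= s ->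
  measurable_fun (setT : set (sub_space (xi M) [set k | k.1 <> a])) G ->
  measurable (B : set (sub_space (xi M) [set k | k.1 <> a])) ->
  (forall w, B w -> `|G w| <= s) ->
  gauss_lower * (e / s) * prob P B <= prob P (B `&` [set w |
    `|G w - (path a ((j + m)%:R / M%:R) w - path a (j%:R / M%:R) w)| <= e]).
Proof.
move=> m0 jmM sE e0 es mG mB BG.
pose Y w := path a ((j + m)%:R / M%:R) w - path a (j%:R / M%:R) w.
have SS' : [set k : nat * nat | k.1 = a] `&` [set k | k.1 <> a] = set0.
  by apply/seteqP; split=> // k [].
have s0 : 0 < s by exact: lt_le_trans es.
have lawY : has_normal_law P Y 0 s.
  by rewrite sE -{1}(addKn j m); apply: grid_path_law => //; lia.
have mY : measurable_fun (setT : set (sub_space (xi M) [set k | k.1 = a])) Y.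
  by apply: measurable_grid_path_incr => //; rewrite leq_addr.
rewrite (_ : [set w | `|G w - _| <= e] = [set w | `|Y w - G w| <= e]); last first.
  by apply/seteqP; split=> w /=; rewrite distrC.
apply: (@prob_near_ge _ _ _ P (xi M) (@mxi M) (@xi_indep M) _ _ SS' Y G B e e0
  mY mG mB _ s) => //.
- by rewrite mulr_ge0 ?divr_ge0// ltW// gauss_lower_gt0.
- move=> x x1 x2; apply: le_trans (gauss_itv_ge s0 lawY _ x1 x2); last by rewrite lerDl ltW.
  by rewrite addrAC subrr add0r.
Qed.

Variables (i j k l : nat) (al be : R).
Hypotheses (jl : j <> l) (ij : i <> j) (kj : k <> j) (il : i <> l) (kl : k <> l)
  (al1 : `|al| <= 1) (be1 : `|be| <= 1).

(** The case [i = k] is allowed: [j] and [l] are the fresh paths, which supply independent noise in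
    the two coordinates. The coefficients will be 0 or 1, for a single path or a difference. *)
Let U (x : R) (w : T) := al * path i x w - path j x w.
Let V (x : R) (w : T) := be * path k x w - path l x w.

Let near_event M m (p q e : R) : set T :=
  [set w | `|U (m%:R / M%:R) w - p| <= e /\ `|V (m%:R / M%:R) w - q| <= e].

(** Path [l] is fresh given the first coordinate, and path [j] given path [i]; each costs a factor
    [3 * e]. *)
Lemma occupation_le M m (p q e : R) : 0 < e ->
  prob P (near_event M m p q e) <= 9 * e ^+ 2.
Proof.
move=> e0; pose x : R := m%:R / M%:R.
pose B := [set w | `|U x w - p| <= e].
have mB : measurable (B : set (sub_space (xi M) [set k | k.1 <> l])).
  apply: measurable_norm_le_event; apply: measurable_funB; last exact: measurable_cst.
  apply: measurable_funB; last by apply: measurable_grid_path.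
  by apply: measurable_funM; [exact: measurable_cst|exact: measurable_grid_path].
have h1 : prob P (near_event M m p q e) <= 3 * e * prob P B.
  have := @grid_near_le M m l (fun w => be * path k x w - q) B e e0 _ mB.
  rewrite (_ : B `&` _ = near_event M m p q e).
    apply; apply: measurable_funB; last exact: measurable_cst.
    by apply: measurable_funM; [exact: measurable_cst|exact: measurable_grid_path].
  by apply/seteqP; split=> w [h1 h2]; split=> //; move: h2; rewrite /V /= addrAC.
have h2 : prob P B <= 3 * e.
  have := @grid_near_le M m j (fun w => al * path i x w - p) setT e e0.
  rewrite setTI prob_setT mulr1 (_ : [set w | _] = B).
    apply=> //; apply: measurable_funB; last exact: measurable_cst.
    by apply: measurable_funM; [exact: measurable_cst|exact: measurable_grid_path].
  by apply/seteqP; split=> w /=; rewrite /B /U /= addrAC.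
by nra.
Qed.

Let DU M n m w := U ((n + m)%:R / M%:R) w - U (n%:R / M%:R) w.
Let DV M n m w := V ((n + m)%:R / M%:R) w - V (n%:R / M%:R) w.

(** Let [s] be the deviation over [m] steps. The increments of [i] and [k] are at most [s] in size
    with probability at least [gauss_lower ^ 2]; those of [j] and [l] then each match their target
    within [e] at the cost of a factor [gauss_lower * (e / s)], and
    [(e / s) ^ 2 = e ^ 2 * (M / m)]. *)
Lemma increment_ge M n m (e : R) :
  (0 < m)%N -> (n + m <= M)%N -> 0 < e -> e ^+ 2 <= m%:R / M%:R ->
  gauss_lower ^+ 4 * (e ^+ 2 * (M%:R / m%:R)) <=
  prob P [set w | `|DU M n m w| <= e /\ `|DV M n m w| <= e].
Proof.
move=> m0 nmM e0 em; pose s := Num.sqrt (m%:R / M%:R : R).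
have mM0 : 0 < m%:R / M%:R :> R by rewrite divr_gt0// ltr0n; lia.
have s0 : 0 < s by rewrite sqrtr_gt0.
have s2 : s ^+ 2 = m%:R / M%:R by rewrite sqr_sqrtr// ltW.
have es : e <= s by rewrite -(@ler_pXn2r _ 2) ?nnegrE ?(ltW e0) ?(ltW s0)// s2.
pose D a w := path a ((n + m)%:R / M%:R) w - path a (n%:R / M%:R) w.
have lawD a : has_normal_law P (D a) 0 s.
  by rewrite /s -{1}(addKn n m); apply: grid_path_law => //; lia.
have mD S a : (forall b, S (a, b)) -> measurable_fun (setT : set (sub_space (xi M) S)) (D a).
  by move=> Sa; apply: measurable_grid_path_incr => //; exact: leq_addr.
have mDle S a : (forall b, S (a, b)) ->
    measurable ([set w | `|D a w| <= s] : set (sub_space (xi M) S)).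
  by move=> Sa; apply: measurable_norm_le_event; exact: mD.
have gl0 := @gauss_lower_gt0 R; have gl1 := @gauss_lower_le1 R.
have pD a : gauss_lower <= prob P [set w | `|D a w| <= s].
  have -> : [set w | `|D a w| <= s] = [set w | - s <= D a w <= s].
    by apply/seteqP; split=> w /=; rewrite ler_norml.
  apply: le_trans (gauss_itv_ge s0 (lawD a) _ _ _); try lra.
  by rewrite opprK -mulr2n -mulr_natl mulfK ?gt_eqF//; lra.
pose B0 := [set w | `|D i w| <= s] `&` [set w | `|D k w| <= s].
have pB0 : gauss_lower ^+ 2 <= prob P B0.
  (* A shared path makes [B0] a single event, of probability at least [gauss_lower], whose square is
     smaller. *)
  have [ik|/eqP ik] := eqVneq i k.
    rewrite /B0 -ik setIid; apply: le_trans (pD i); rewrite expr2; nra.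
  rewrite (@indep_sub_spaces _ _ _ P (xi M) (@mxi M) (@xi_indep M)
    [set x | x.1 = i] [set x | x.1 = k]).
  - by rewrite expr2; apply: ler_pM => //; rewrite ltW.
  - by apply/seteqP; split=> // -[a b] /= [-> ?].
  - exact: mDle.
  - exact: mDle.
pose GU w := al * D i w; pose GV w := be * D k w.
pose B1 := B0 `&` [set w | `|GU w - D j w| <= e].
pose B2 := B1 `&` [set w | `|GV w - D l w| <= e].
have mB0 a : i <> a -> k <> a -> measurable (B0 : set (sub_space (xi M) [set x | x.1 <> a])).
  by move=> ia ka; apply: measurableI; apply: mDle.
have h1 : gauss_lower * (e / s) * prob P B0 <= prob P B1.
  apply: (@increment_near_ge M n m j GU B0 e s) => //.
  - by apply: measurable_funM; [exact: measurable_cst|exact: mD].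
  - exact: mB0.
  - move=> w [Diw _]; rewrite /GU normrM; apply: le_trans Diw.
    exact: ler_piMl.
have h2 : gauss_lower * (e / s) * prob P B1 <= prob P B2.
  apply: (@increment_near_ge M n m l GV B1 e s) => //.
  - by apply: measurable_funM; [exact: measurable_cst|exact: mD].
  - apply: measurableI; first exact: mB0.
    apply: measurable_norm_le_event; apply: measurable_funB; last exact: mD.
    by apply: measurable_funM; [exact: measurable_cst|exact: mD].
  - move=> w [[_ Dkw] _]; rewrite /GV normrM; apply: le_trans Dkw.
    exact: ler_piMl.
have mT (f : T -> R) (c : R) : measurable_fun setT f -> measurable [set w | `|f w| <= c].
  by move=> mf; exact: measurable_norm_le_event.
have mDT a : measurable_fun setT (D a).
  by apply: measurable_funB; exact: measurable_path.
have h3 : prob P B2 <= prob P [set w | `|DU M n m w| <= e /\ `|DV M n m w| <= e].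
  have mU x : measurable_fun setT (U x).
    apply: measurable_funB; last exact: measurable_path.
    by apply: measurable_funM; [exact: measurable_cst|exact: measurable_path].
  have mV x : measurable_fun setT (V x).
    apply: measurable_funB; last exact: measurable_path.
    by apply: measurable_funM; [exact: measurable_cst|exact: measurable_path].
  apply: prob_le.
  - apply: measurableI; [apply: measurableI; first by apply: measurableI; exact: mT|];
      by apply: mT; apply: measurable_funB => //; apply: measurable_funM => //;
        exact: measurable_cst.
  - by apply: measurableI; apply: mT; apply: measurable_funB.
  - move=> w [[_ /= u] /= v]; split=> /=.
      by move: u; rewrite /GU /DU /U /D; congr (`|_| <= _); ring.
    by move: v; rewrite /GV /DV /V /D; congr (`|_| <= _); ring.
apply: le_trans h3; apply: le_trans h2.
have es0 : 0 <= e / s by rewrite divr_ge0// ltW.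
have -> : e ^+ 2 * (M%:R / m%:R) = (e / s) ^+ 2.
  by rewrite expr_div_n s2 invf_div.
have -> : gauss_lower ^+ 4 * (e / s) ^+ 2 =
    gauss_lower * (e / s) * (gauss_lower * (e / s) * gauss_lower ^+ 2) by ring.
have ge0 : 0 <= gauss_lower * (e / s) by rewrite mulr_ge0// ltW.
by rewrite ler_wpM2l//; apply: le_trans h1; rewrite ler_wpM2l.
Qed.

Let measurable_near M m p q e : measurable (near_event M m p q e).
Proof.
apply: measurableI; apply: measurable_norm_le_event;
  apply: measurable_funB; try exact: measurable_cst.
  apply: measurable_funB; last exact: measurable_path.
  by apply: measurable_funM; [exact: measurable_cst|exact: measurable_path].
apply: measurable_funB; last exact: measurable_path.
by apply: measurable_funM; [exact: measurable_cst|exact: measurable_path].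
Qed.

(* Occupation-time argument: the expected time spent near the target is of
   order [e ^ 2], but after a first visit it is larger by the logarithmic
   factor coming from [harmonic_ge]. *)
Lemma hit_prob_le M K n (p q e : R) : (0 < n)%N -> 0 < e ->
  e ^+ 2 * M%:R = n%:R -> (n * 4 ^ K <= M)%N ->
  prob P [set w | exists m, (m < M - n * 4 ^ K)%N /\ near_event M m p q e w] *
    (gauss_lower ^+ 4 * K%:R) <= 36.
Proof.
move=> n0 e0 eM WM; set W := (n * 4 ^ K)%N; set J := (M - W)%N.
have n0R : (0 : R) < n%:R by rewrite ltr0n.
have gl0 := @gauss_lower_gt0 R.
(* First visit at index [m]: these events are disjoint and depend on the past of [m] only. *)
pose H m : set T := [set w | near_event M m p q e w /\
  forall m', (m' < m)%N -> ~ near_event M m' p q e w].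
have mlin S c a b x y : (forall a b, (x < b <= y)%N -> S (a, b)) -> (x <= y)%N ->
    measurable_fun (setT : set (sub_space (xi M) S))
    (fun w => (c * path a (y%:R / M%:R) w - path b (y%:R / M%:R) w) -
      (c * path a (x%:R / M%:R) w - path b (x%:R / M%:R) w)).
  move=> hS xy; rewrite (_ : (fun w => _) = (fun w =>
      c * (path a (y%:R / M%:R) w - path a (x%:R / M%:R) w)) \-
      (fun w => path b (y%:R / M%:R) w - path b (x%:R / M%:R) w)).
    apply: measurable_funB; last by apply: measurable_grid_path_incr => // ? /hS.
    apply: measurable_funM; first exact: measurable_cst.
    by apply: measurable_grid_path_incr => // ? /hS.
  by apply/funext => w /=; ring.
have mnear m m' : (m' <= m)%N ->
    measurable (near_event M m' p q e : set (sub_space (xi M) (past m))).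
  move=> mm'.
  have mp a : measurable_fun (setT : set (sub_space (xi M) (past m)))
      (path a (m'%:R / M%:R)).
    by apply: measurable_grid_path => b bm; rewrite /past /=; exact: leq_trans mm'.
  apply: measurableI; apply: measurable_norm_le_event;
    (apply: measurable_funB; last exact: measurable_cst);
    (apply: measurable_funB; last exact: mp);
    by apply: measurable_funM; [exact: measurable_cst|exact: mp].
have mH m : measurable (H m : set (sub_space (xi M) (past m))).
  apply: measurable_and_event; first exact: mnear.
  apply: measurable_forall_event => m'; apply: measurable_imply_event => m'm.
  by apply: measurable_not_event; apply: mnear; exact: ltnW.
have mHT m : measurable (H m) by exact: sub_space_measurable (mH m).
have dH x y w : H x w -> H y w -> x = y.
  by case: (ltngtP x y) => // xy [h1 h2] [h3 h4]; [have := h4 _ xy|have := h2 _ xy].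
(* Radius [e] at the first visit, plus an increment of at most [e]. *)
pose O m := near_event M m p q (2 * e).
have mO m : measurable (O m) by exact: measurable_near.
set A := [set w | _].
have mA : measurable A.
  by apply: measurable_exists_event => m; apply: measurable_cst_and_event => _;
    exact: measurable_near.
have AH : prob P A <= \sum_(m < J) prob P (H m).
  apply: prob_cover_le => // w Aw.
  have [m [mJ nm] fm] := ex_first Aw; exists m => //; split=> // m' m'm nm'.
  by apply: (fm _ m'm); split=> //; exact: ltn_trans mJ.
(* The condition [n <= t] is what [increment_ge] asks for, since [e ^ 2 * M = n]; [t < W] and
   [m < J] keep [m + t] on the grid. *)
have step m t : (m < J)%N -> (n <= t < W)%N ->
    gauss_lower ^+ 4 * (n%:R / t%:R) * prob P (H m) <= prob P (H m `&` O (m + t)%N).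
  move=> mJ /andP[nt tW].
  have t0 : (0 < t)%N by exact: leq_trans nt.
  have tMJ : (m + t <= M)%N by rewrite /J in mJ; lia.
  have M0 : (0 : R) < M%:R by rewrite ltr0n; lia.
  pose I := [set w | `|DU M m t w| <= e /\ `|DV M m t w| <= e].
  have mI : measurable (I : set (sub_space (xi M) (future m))).
    apply: measurableI; apply: measurable_norm_le_event; apply: mlin => //;
      by [move=> ? ? /andP[]|exact: leq_addr].
  apply: (@le_trans _ _ (prob P (H m `&` I))).
    rewrite (indep_sub_spaces (@mxi M) (@xi_indep M) (past_future m) (mH m) mI) mulrC.
    rewrite ler_wpM2l ?prob_ge0//.
    have -> : n%:R / t%:R = e ^+ 2 * (M%:R / t%:R) :> R by rewrite mulrA eM.
    by apply: increment_ge => //; rewrite ler_pdivlMr// eM ler_nat.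
  apply: prob_le.
  - by apply: measurableI => //; exact: sub_space_measurable mI.
  - exact: measurableI.
  - move=> w [Hw [Iu Iv]]; split=> //; case: Hw => -[/= nu nv] _.
    by split=> /=; move: Iu Iv nu nv; rewrite /DU /DV !ler_norml => /andP[? ?]
      /andP[? ?] /andP[? ?] /andP[? ?]; lra.
(* [harmonic_ge], used with [4 ^ K = 2 ^ (2 * K)], bounds the sum of [n / t] over the window from
   below by [n * K]. *)
have stepS m : (m < J)%N ->
    gauss_lower ^+ 4 * (n%:R * K%:R) * prob P (H m) <=
    \sum_(u < M) prob P (H m `&` O u).
  move=> mJ.
  apply: (@le_trans _ _ (\sum_(n <= t < W) prob P (H m `&` O (t + m)%N))).
    apply: (@le_trans _ _ (\sum_(n <= t < W)
        gauss_lower ^+ 4 * (n%:R / t%:R) * prob P (H m))).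
      rewrite -mulr_suml -mulr_sumr ler_wpM2r ?prob_ge0// ler_wpM2l ?(exprn_ge0 _ (ltW gl0))//.
      have := @harmonic_ge R n (2 * K) n0; rewrite expnM; apply: le_trans.
      by rewrite !natrM; lra.
    apply: ler_sum_nat => t tW.
    by rewrite addnC; exact: step.
  rewrite -(big_mkord xpredT (fun u => prob P (H m `&` O u))).
  have := big_addn n (W + m)%N m xpredT (fun u => prob P (H m `&` O u)).
  rewrite addnK => /(_ 0 +%R) <-.
  have h1 : (n + m <= W + m)%N by rewrite leq_add2r leq_pmulr// expn_gt0.
  have h2 : (W + m <= M)%N by rewrite /J in mJ; lia.
  rewrite (big_cat_nat (leq0n (n + m)%N) (leq_trans h1 h2))/= (big_cat_nat h1 h2)/=.
  by rewrite addrCA lerDl addr_ge0// sumr_ge0// => u _; exact: prob_ge0.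
(* For each [u] the first visits are disjoint parts of [O u]; this leaves [M] terms of at most
   [9 * (2 * e) ^ 2], and [e ^ 2 * M = n]. *)
have total : gauss_lower ^+ 4 * (n%:R * K%:R) * \sum_(m < J) prob P (H m) <= 36 * n%:R.
  rewrite mulr_sumr; apply: (@le_trans _ _
      (\sum_(m < J) \sum_(u < M) prob P (H m `&` O u))).
    by apply: ler_sum => m _; exact: stepS.
  rewrite exchange_big/=; apply: (@le_trans _ _ (\sum_(u < M) (36 * e ^+ 2))).
    apply: ler_sum => u _.
    apply: (@le_trans _ _ (prob P (O u))).
      apply: (@prob_disjoint_le _ _ _ P J (fun m => H m `&` O u)) => //.
      - by move=> m _; exact: measurableI.
      - by move=> x y w _ _ [hx _] [hy _]; exact: dH hx hy.
      - by move=> m w _ [].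
    have e20 : 0 < 2 * e by lra.
    apply: le_trans (occupation_le _ _ _ _ e20) _.
    by rewrite exprMn; lra.
  by rewrite sumr_const card_ord -[leLHS]mulr_natr -mulrA eM.
rewrite -(ler_pM2r n0R); apply: le_trans total.
have -> : gauss_lower ^+ 4 * (n%:R * K%:R) * \sum_(m < J) prob P (H m) =
    (\sum_(m < J) prob P (H m)) * (gauss_lower ^+ 4 * K%:R) * n%:R by ring.
have g4 : 0 <= @gauss_lower R ^+ 4 * K%:R by rewrite mulr_ge0// exprn_ge0// ltW.
by rewrite ler_wpM2r ?ler0n// ler_wpM2r.
Qed.

Let continuous_lin c a b w : continuous (fun x => c * path a x w - path b x w).
Proof.
move=> x; apply: cvgB; last exact: continuous_path.
by apply: cvgM; [exact: cvg_cst|exact: continuous_path].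
Qed.

(** The radius [e] depends on [r] and [K] only, while the mesh tends to 0. The choice makes
    [e ^ 2 * M = n + 1] exact, and the window of [(n + 1) * 4 ^ K] steps is the fraction [1 / r ^ 2]
    of the grid; times up to [1 - 2 / r ^ 2] leave room for it. *)
Lemma planar_hit_before_negligible r (p q : R) : (0 < r)%N ->
  P.-negligible [set w | exists x : R, [/\ 0 <= x, x <= 1 - 2 / (r ^ 2)%:R,
    U x w = p & V x w = q]].
Proof.
move=> r0; apply: negligible_liminf => eps eps0.
have gl0 : 0 < @gauss_lower R ^+ 4 by rewrite exprn_gt0 ?gauss_lower_gt0.
pose K := (Num.truncn (36 / gauss_lower ^+ 4 / eps)).+1.
have K0 : (0 : R) < K%:R by rewrite ltr0n.
have gK0 : 0 < @gauss_lower R ^+ 4 * K%:R by exact: mulr_gt0.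
have hK : 36 / (gauss_lower ^+ 4 * K%:R) <= eps.
  rewrite invfM mulrA ler_pdivrMr// -ler_pdivrMl// mulrC.
  by apply: ltW; exact: truncnS_gt.
clearbody K; have r0R : (0 : R) < r%:R by rewrite ltr0n.
pose e : R := (r%:R * 2 ^+ K)^-1.
have e0 : 0 < e by rewrite invr_gt0 mulr_gt0 ?exprn_gt0.
pose M n := (r ^ 2 * 4 ^ K * n.+1)%N.
have eM n : e ^+ 2 * (M n)%:R = n.+1%:R.
  rewrite /e /M !natrM !natrX exprVn exprMn -exprM mulnC exprM (_ : 2 ^+ 2 = 4 :> R); last by ring.
  by have h4 : (4 : R) ^+ K != 0 by [rewrite expf_neq0]; field; rewrite h4 gt_eqF.
have leM n : (n.+1 * 4 ^ K <= M n)%N.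
  by rewrite /M -mulnA [(4 ^ K * _)%N]mulnC leq_pmull// expn_gt0 r0.
exists (fun n => [set w | exists m, (m < M n - n.+1 * 4 ^ K)%N /\
  near_event (M n) m p q e w]); split.
- move=> n; apply: measurable_exists_event => m.
  by apply: measurable_cst_and_event => _; exact: measurable_near.
- move=> n; apply: le_trans hK; rewrite (ler_pdivlMr _ _ gK0).
  exact: hit_prob_le.
- move=> w [x [x0 x1 Ux Vx]].
  have [d1 d10 hU] := continuous_distP x (@continuous_lin al i j w) e0.
  have [d2 d20 hV] := continuous_distP x (@continuous_lin be k l w) e0.
  pose dl := Num.min d1 d2; have dl0 : 0 < dl by rewrite lt_min d10.
  have hdl y : `|x - y| < dl -> `|U y w - p| <= e /\ `|V y w - q| <= e.
    by rewrite lt_min => /andP[/hU ? /hV ?]; rewrite -Ux -Vx.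
  exists (Num.truncn dl^-1) => n n0n.
  have M0 : (0 : R) < (M n)%:R by rewrite ltr0n (leq_trans _ (leM n))// muln_gt0 expn_gt0.
  pose m := Num.truncn (x * (M n)%:R).
  have xM0 : 0 <= x * (M n)%:R by rewrite mulr_ge0// ltW.
  have /andP[m1 m2] := truncn_itv xM0.
  exists m; split; last first.
    apply: hdl => /=; rewrite -/m in m1 m2.
    have -> : x - m%:R / (M n)%:R = (x * (M n)%:R - m%:R) / (M n)%:R.
      by field; rewrite gt_eqF.
    rewrite normrM normfV (gtr0_norm M0) ltr_pdivrMr//.
    have nM : (n.+1 <= M n)%N by apply: leq_trans (leM n); rewrite leq_pmulr// expn_gt0.
    have h1 : 1 < dl * (M n)%:R.
      rewrite -ltr_pdivrMl// mulr1; apply: lt_le_trans (truncnS_gt _) _.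
      by rewrite ler_nat; exact: leq_trans nM.
    apply: lt_trans h1; rewrite ger0_norm ?subr_ge0// ltrBlDl.
    by move: m2; rewrite -natr1 addrC.
  rewrite -(ltr_nat R) natrB ?leM//; apply: le_lt_trans m1 _.
  apply: (@le_lt_trans _ _ ((1 - 2 / (r ^ 2)%:R) * (M n)%:R)).
    by rewrite ler_pM2r.
  have -> : (1 - 2 / (r ^ 2)%:R) * (M n)%:R = (M n)%:R - 2 * (n.+1 * 4 ^ K)%:R :> R.
    rewrite /M !natrM !natrX; field; by rewrite gt_eqF.
  have : (0 : R) < (n.+1 * 4 ^ K)%:R by rewrite ltr0n muln_gt0 expn_gt0.
  by lra.
Qed.

(** Time 1 leaves no room for a window after the visit; there the bound [9 * e ^ 2] for one fixed
    time takes over. *)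
Lemma planar_misses_point (p q : R) :
  P.-negligible [set w | exists x : R, [/\ 0 <= x <= 1, U x w = p & V x w = q]].
Proof.
have h1 : P.-negligible [set w | exists r, (0 < r)%N /\ exists x : R,
    [/\ 0 <= x, x <= 1 - 2 / (r ^ 2)%:R, U x w = p & V x w = q]].
  apply: negligible_exists_nat => r; apply: negligible_imply => r0.
  exact: planar_hit_before_negligible.
have h2 : P.-negligible [set w | U 1 w = p /\ V 1 w = q].
  apply: negligible_le => eps eps0; pose e := Num.min 1 eps / 9.
  have [e0 [e1 e2]] : 0 < e /\ 9 * e <= 1 /\ 9 * e <= eps.
    rewrite /e mulrCA divff// mulr1 divr_gt0 ?lt_min ?ltr01//.
    by split=> //; split; rewrite ge_min lexx ?orbT.
  exists (near_event 1 1 p q e); split; first exact: measurable_near.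
    by apply: le_trans (occupation_le _ _ _ _ e0) _; nra.
  by move=> w [/= Uw Vw]; rewrite /near_event /= divr1 Uw Vw !subrr normr0 ltW.
apply: negligibleS (negligibleU h1 h2) => w [x [/andP[x0 x1] Ux Vx]].
have [x1'|x1'] := eqVneq x 1; [right|left]; first by rewrite -x1'.
have {x1 x1'} x1 : 0 < 1 - x by rewrite subr_gt0 lt_neqAle x1' x1.
pose r := (Num.truncn (2 / (1 - x))).+1; exists r; split=> //; exists x; split=> //.
have r0 : (0 : R) < r%:R by rewrite ltr0n.
have hr : 2 < r%:R * (1 - x) by rewrite -ltr_pdivrMr//; exact: truncnS_gt.
have r1 : (1 : R) <= r%:R by rewrite ler1n.
suff : 2 / (r ^ 2)%:R <= 1 - x by lra.
rewrite natrX ler_pdivrMr ?exprn_gt0// expr2 mulrA.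
by apply: le_trans (ltW hr) _; nra.
Qed.

End planar.

(** * Oscillation at level crossings *)

Lemma expr_small (R : realType) (x e : R) : 0 <= x < 1 -> 0 < e ->
  exists n, x ^+ n <= e.
Proof.
move=> /andP[x0 x1] e0.
have : x ^+ n @[n --> \oo] --> 0 by apply: cvg_expr; rewrite ger0_norm.
move=> /cvgrPdist_le/(_ _ e0)[n _ h]; exists n.
by have := h n (leqnn n); rewrite sub0r normrN; apply: le_trans; exact: ler_norm.
Qed.

Section oscillation.
Context {R : realType} {d : measure_display} {T : measurableType d}.
Variable P : probability T R.
Variables (N : nat -> {RV P >-> R}) (X : nat -> unitI R -> {RV P >-> R}).
Hypotheses (N_indep : indep_rvs P (fun n : nat => (N n : T -> R)))
  (X_brownian : forall n, standard_brownian_motion P (fun t => (X n t : T -> R)))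
  (X_indep : indep_processes P (fun (n : nat) t => (X n t : T -> R)))
  (NX_indep : indep2 P
     (sigma_gen (fun n : nat => (N n : T -> R)))
     (sigma_gen (fun nt : nat * unitI R => (X nt.1 nt.2 : T -> R)))).

Local Notation path := (path N X).
Local Notation xi := (grid_incr N X).

Let xi_indep M : box_indep P (xi M).
Proof. exact: grid_box_indep. Qed.

Let mxi M a b : measurable_fun setT (xi M a b).
Proof. exact: measurable_grid_incr. Qed.

Definition path_diff a b (x : R) (w : T) : R := path a x w - path b x w.

Lemma measurable_path_diff a b x : measurable_fun setT (path_diff a b x).
Proof. by apply: measurable_funB; exact: measurable_path. Qed.

Lemma continuous_path_diff a b w : continuous (fun x => path_diff a b x w).
Proof. by move=> x; apply: cvgB; exact: continuous_path. Qed.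

Let measurable_grid_diff M j m a b : (j <= m)%N ->
  measurable_fun (setT : set (sub_space (xi M) (past m))) (path_diff a b (j%:R / M%:R)).
Proof.
move=> jm; apply: measurable_funB; apply: measurable_grid_path => // i ij;
  by rewrite /past /=; exact: leq_trans jm.
Qed.

Let measurable_grid_diff_incr S M j k a b : (j <= k)%N ->
  (forall c i, (j < i <= k)%N -> S (c, i)) ->
  measurable_fun (setT : set (sub_space (xi M) S))
    (fun w => path_diff a b (k%:R / M%:R) w - path_diff a b (j%:R / M%:R) w).
Proof.
move=> jk hS; rewrite (_ : (fun w => _) =
    (fun w => path a (k%:R / M%:R) w - path a (j%:R / M%:R) w) \-
    (fun w => path b (k%:R / M%:R) w - path b (j%:R / M%:R) w)).
  by apply: measurable_funB; apply: measurable_grid_path_incr => // i /hS.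
by apply/funext => w /=; rewrite /path_diff; ring.
Qed.

(** One of the two increments must exceed [u / 2] in size, which has probability at most [8 * s / u]
    for each. *)
Lemma diff_incr_tail M a b j k (s u : R) : (j < k)%N -> (k <= M)%N ->
  s = Num.sqrt ((k - j)%:R / M%:R) -> 0 < u ->
  prob P [set w | u < `|path_diff a b (k%:R / M%:R) w - path_diff a b (j%:R / M%:R) w|]
    <= 16 * s / u.
Proof.
move=> jk kM sE u0.
have s0 : 0 < s.
  by rewrite sE sqrtr_gt0 divr_gt0// ltr0n ?subn_gt0//; lia.
pose D c w := path c (k%:R / M%:R) w - path c (j%:R / M%:R) w.
have mD c : measurable_fun setT (D c) by apply: measurable_funB; exact: measurable_path.
have tail c : prob P [set w | u / 2 < `|D c w|] <= 8 * s / u.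
  have -> : 8 * s / u = 4 * s / (u / 2) by field; rewrite gt_eqF.
  apply: gauss_tail => //; last by rewrite divr_gt0.
  by rewrite sE; exact: grid_path_law.
have mt c : measurable [set w | u / 2 < `|D c w|].
  by apply: measurable_lt_event; [exact: measurable_cst|exact: measurableT_comp].
have -> : 16 * s / u = 8 * s / u + 8 * s / u by ring.
apply: le_trans (lerD (tail a) (tail b)).
apply: le_trans (prob_setU_le P (mt a) (mt b)); apply: prob_le.
- apply: measurable_lt_event; first exact: measurable_cst.
  apply: measurableT_comp => //; apply: measurable_funB; exact: measurable_path_diff.
- exact: measurableU.
- move=> w /= h.
  have [ha|ha] := ltP (u / 2) `|D a w|; first by left.
  right => /=; rewrite ltNge; apply/negP => hb.
  have := ler_normB (D a w) (D b w).
  rewrite (_ : D a w - D b w = path_diff a b (k%:R / M%:R) w -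
    path_diff a b (j%:R / M%:R) w); last by rewrite /D /path_diff; ring.
  by lra.
Qed.

(** The increment of the difference is at least [s] when that of [a] lies in [[s, 2s]] and that of
    [b] in [[-s, 0]]: two independent events of probability at least [gauss_lower]. *)
Lemma diff_incr_gt M a b j k (s u : R) : a <> b -> (j < k)%N -> (k <= M)%N ->
  s = Num.sqrt ((k - j)%:R / M%:R) -> u < s ->
  prob P [set w | path_diff a b (k%:R / M%:R) w - path_diff a b (j%:R / M%:R) w <= u]
    <= 1 - gauss_lower ^+ 2.
Proof.
move=> ab jk kM sE us.
have s0 : 0 < s.
  by rewrite sE sqrtr_gt0 divr_gt0// ltr0n ?subn_gt0//; lia.
pose D c w := path c (k%:R / M%:R) w - path c (j%:R / M%:R) w.
have lawD c : has_normal_law P (D c) 0 s by rewrite sE; exact: grid_path_law.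
pose A := [set w | s <= D a w <= 2 * s].
pose B := [set w | - s <= D b w <= 0].
have mitv c S (x y : R) : (forall i, S (c, i)) ->
    measurable ([set w | x <= D c w <= y] : set (sub_space (xi M) S)).
  move=> Sc; have mDc : measurable_fun (setT : set (sub_space (xi M) S)) (D c).
    by apply: measurable_grid_path_incr => //; exact: ltnW.
  rewrite (_ : [set w | _] = [set w | x <= D c w] `&` [set w | D c w <= y]).
    by apply: measurableI; apply: measurable_le_event => //; exact: measurable_cst.
  by apply/seteqP; split=> w /=; [move=> /andP|move=> [-> ->]].
have mA := mitv a [set x | x.1 = a] s (2 * s) (fun=> erefl).
have mB := mitv b [set x | x.1 = b] (- s) 0 (fun=> erefl).
have SS : [set x : nat * nat | x.1 = a] `&` [set x | x.1 = b] = set0.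
  by apply/seteqP; split=> // -[x y] /= [-> /ab].
have mAB : measurable (A `&` B).
  by apply: measurableI; [exact: sub_space_measurable mA|exact: sub_space_measurable mB].
have hAB : gauss_lower ^+ 2 <= prob P (A `&` B).
  rewrite (indep_sub_spaces (@mxi M) (@xi_indep M) SS mA mB) expr2.
  have gl0 := ltW (@gauss_lower_gt0 R).
  apply: ler_pM => //.
    apply: le_trans (gauss_itv_ge s0 (lawD a) _ _ _); try lra.
    by rewrite (_ : 2 * s - s = s) ?divff ?mulr1 ?gt_eqF//; ring.
  apply: le_trans (gauss_itv_ge s0 (lawD b) _ _ _); try lra.
  by rewrite sub0r opprK divff ?mulr1 ?gt_eqF.
have : prob P [set w | path_diff a b (k%:R / M%:R) w - path_diff a b (j%:R / M%:R) w <= u]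
    <= prob P (~` (A `&` B)).
  apply: prob_le.
  - apply: measurable_le_event; last exact: measurable_cst.
    by apply: measurable_funB; exact: measurable_path_diff.
  - exact: measurableC.
  - move=> w /= h [/= /andP[h1 h2] /andP[h3 h4]].
    by move: h h1 h2 h3 h4; rewrite /path_diff /D; lra.
by rewrite prob_setC//; lra.
Qed.

(* The geometric times make the increments dominate the earlier positions, so
   that staying below [om] forces many independent increments to be small. *)
Lemma one_sided_prob_le c (eps : R) : (0 < c)%N -> 0 < eps ->
  exists rn om, [/\ (0 < rn)%N, 0 < om & forall n' a b j, (0 < n')%N -> a <> b ->
    (j + rn * n' <= c * (rn * n'))%N ->
    let M := (c * (rn * n'))%N in
    prob P [set w | forall m, (m <= rn * n')%N ->
      path_diff a b ((j + m)%:R / M%:R) w - path_diff a b (j%:R / M%:R) w <= om]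
    <= eps].
Proof.
move=> c0 eps0.
have gl0 := @gauss_lower_gt0 R; have gl1 := @gauss_lower_le1 R.
(* [n] is the number of scales: all their increments are small with probability at most
   [eps / 2]. *)
have [n hn] : exists n, (1 - gauss_lower ^+ 2) ^+ n <= eps / 2.
  by apply: expr_small; [rewrite expr2; nra|rewrite divr_gt0].
(* Ratio of the deviations at successive scales, chosen so that [n] tail bounds [64 / rho] sum to at
   most [eps / 2]. *)
pose rho := (Num.truncn (64 * n%:R / (eps / 2))).+2.
have rho0 : (0 : R) < rho%:R by rewrite ltr0n.
have rho2 : (2 : R) <= rho%:R by rewrite ler_nat.
have hrho : n%:R * (64 / rho%:R) <= eps / 2.
  rewrite mulrA ler_pdivrMr// -ler_pdivrMl ?divr_gt0// mulrC [n%:R * _]mulrC.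
  apply: le_trans (ltW (truncnS_gt _)) _; by rewrite ler_nat.
pose rn := ((rho ^ 2) ^ n)%N.
have rn0 : (0 < rn)%N by rewrite !expn_gt0.
(* Deviation at the smallest scale, [n'] steps of mesh [1 / (c * rn * n')]: [n'] cancels, so [om]
   does not depend on the mesh. *)
pose s0 : R := Num.sqrt ((c * rn)%:R)^-1.
have crn0 : (0 : R) < (c * rn)%:R by rewrite ltr0n muln_gt0 c0.
have s00 : 0 < s0 by rewrite sqrtr_gt0 invr_gt0.
exists rn, (s0 / 4); split=> //; first by rewrite divr_gt0.
move=> n' a b j n'0 ab; set M := (c * (rn * n'))%N => jM.
pose L i := (n' * (rho ^ 2) ^ i)%N.
pose s i : R := rho%:R ^+ i * s0.
have LS i : (L i < L i.+1)%N.
  have : (1 ^ 2 < rho ^ 2)%N by rewrite ltn_exp2r.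
  by rewrite exp1n => rho1; rewrite /L ltn_mul2l n'0/= ltn_exp2l.
have Lmono i k : (i <= k)%N -> (L i <= L k)%N.
  by move=> ik; rewrite leq_mul2l leq_pexp2l ?expn_gt0// orbT.
have Ln : L n = (rn * n')%N by rewrite /L mulnC.
have L0 i : (0 < L i)%N by rewrite muln_gt0 n'0 !expn_gt0.
have LM i : (i <= n)%N -> (j + L i <= M)%N.
  by move=> /Lmono; rewrite Ln => h; apply: leq_trans jM; rewrite leq_add2l.
have s2 i : s i ^+ 2 = (L i)%:R / M%:R.
  rewrite exprMn sqr_sqrtr ?invr_ge0 ?ltW// /L /M mulnA !natrM -exprM mulnC exprM -!natrX.
  set u := ((rho ^ 2) ^ i)%N.
  by field; rewrite !pnatr_eq0 -!lt0n c0 n'0 rn0.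
have spos i : 0 < s i by rewrite mulr_gt0 ?exprn_gt0.
have sS i : s i.+1 = rho%:R * s i by rewrite /s exprS mulrA.
have s0s i : s0 <= s i.
  by rewrite -[leLHS]mul1r ler_pM2r// exprn_ege1//; lra.
have sE i : s i = Num.sqrt ((j + L i - j)%:R / M%:R).
  by rewrite addKn -s2 sqrtr_sqr gtr0_norm.
pose W i w := path_diff a b ((j + L i)%:R / M%:R) w - path_diff a b (j%:R / M%:R) w.
pose I i w := path_diff a b ((j + L i.+1)%:R / M%:R) w -
  path_diff a b ((j + L i)%:R / M%:R) w.
have mW i : measurable_fun setT (W i).
  by apply: measurable_funB; exact: measurable_path_diff.
have mI i : measurable_fun setT (I i).
  by apply: measurable_funB; exact: measurable_path_diff.
pose F i := [set w | s i.+1 / 4 < `|W i w|].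
pose Q k := [set w | forall i, (i < k)%N -> I i w <= s i.+1 / 2].
have mF i : measurable (F i).
  by apply: measurable_lt_event; [exact: measurable_cst|exact: measurableT_comp].
have mQ k : measurable (Q k : set (sub_space (xi M) (past (j + L k)))).
  apply: measurable_forall_event => i; apply: measurable_imply_event => ik.
  apply: measurable_le_event; last exact: measurable_cst.
  apply: measurable_funB; apply: measurable_grid_diff; rewrite leq_add2l; apply: Lmono => //.
  exact: ltnW.
have mQT k : measurable (Q k) by exact: sub_space_measurable (mQ k).
have pF i : (i < n)%N -> prob P (F i) <= 64 / rho%:R.
  move=> ik; have u0 : 0 < s i.+1 / 4 by rewrite divr_gt0.
  have := @diff_incr_tail M a b j (j + L i)%N (s i) _ _ (LM _ (ltnW ik)) (sE i) u0.
  move=> /(_ _)/le_trans; apply; first by rewrite -addn1 leq_add2l.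
  rewrite sS le_eqVlt; apply/orP; left; apply/eqP.
  by have /gt_eqF h1 := spos i; have /gt_eqF h2 := rho0; field; rewrite h1 h2.
have pQ k : (k <= n)%N -> prob P (Q k) <= (1 - gauss_lower ^+ 2) ^+ k.
  elim: k => [|k IH] kn; first by rewrite expr0 prob_le1.
  have mI' : measurable ([set w | I k w <= s k.+1 / 2] :
      set (sub_space (xi M) (future (j + L k)))).
    apply: measurable_le_event; last exact: measurable_cst.
    apply: measurable_grid_diff_incr; first by rewrite leq_add2l ltnW.
    by move=> ? i /andP[].
  have -> : Q k.+1 = Q k `&` [set w | I k w <= s k.+1 / 2].
    apply/seteqP; split=> w.
      by move=> h; split=> [i ik|]; apply: h => //; exact: ltnW.
    by move=> [h1 h2] i; rewrite ltnS leq_eqVlt => /predU1P[->//|]; exact: h1.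
  rewrite (indep_sub_spaces (@mxi M) (@xi_indep M) (@past_future _) (mQ k) mI') exprSr.
  apply: ler_pM; rewrite ?prob_ge0//; first by apply: IH; exact: ltnW.
  apply: (diff_incr_gt (s := Num.sqrt (((j + L k.+1) - (j + L k))%:R / M%:R))) => //.
  - by rewrite ltn_add2l.
  - exact: LM.
  (* Over this step each path has variance [s k.+1 ^ 2 - s k ^ 2], at least three quarters of
     [s k.+1 ^ 2] because [rho >= 2]. *)
  - have h3 : (s k.+1 / 2) ^+ 2 < ((j + L k.+1) - (j + L k))%:R / M%:R.
      rewrite subnDl natrB ?(ltnW (LS k))// mulrBl -!s2 sS expr_div_n exprMn.
      have q0 : 0 < s k ^+ 2 by rewrite exprn_gt0.
      have u4 : (4 : R) <= rho%:R ^+ 2 by rewrite expr2; nra.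
      by move: (s k ^+ 2) (rho%:R ^+ 2) q0 u4 => q u q0 u4; nra.
    rewrite -(@ltr_pXn2r _ 2) ?nnegrE ?sqrtr_ge0 ?divr_ge0 ?(ltW (spos _))//.
    by rewrite sqr_sqrtr// (le_trans _ (ltW h3))// sqr_ge0.
cbv zeta; set B := [set w | _].
have mB : measurable B.
  apply: measurable_forall_event => m; apply: measurable_imply_event => _.
  apply: measurable_le_event; last exact: measurable_cst.
  by apply: measurable_funB; exact: measurable_path_diff.
pose FU := [set w | exists i, (i < n)%N /\ F i w].
have mFU : measurable FU.
  by apply: measurable_exists_event => i; apply: measurable_cst_and_event => _; exact: mF.
have pFU : prob P FU <= eps / 2.
  apply: le_trans hrho.
  apply: (@le_trans _ _ (\sum_(i < n) prob P (F i))).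
    by apply: prob_cover_le => // w [i [ik Fi]]; exists i.
  apply: (@le_trans _ _ (\sum_(i < n) (64 / rho%:R))).
    by apply: ler_sum => i _; exact: pF.
  by rewrite sumr_const card_ord -[leLHS]mulr_natl.
have : prob P B <= prob P (FU `|` Q n).
  apply: prob_le => //; first exact: measurableU.
  move=> w Bw; have [|nF] := pselect (FU w); [by left|right=> i ik].
  (* Off [FU], an increment is at most [om] plus the size of the earlier position, and each of these
     is at most a quarter of [s i.+1]. *)
  have WE : I i w = W i.+1 w - W i w by rewrite /I /W; ring.
  have h1 : W i.+1 w <= s0 / 4.
    by apply: Bw; rewrite -Ln; apply: Lmono.
  have h2 : `|W i w| <= s i.+1 / 4.
    by rewrite leNgt; apply/negP => Fi; apply: nF; exists i.
  have := s0s i.+1; have := ler_norm (- W i w); rewrite normrN WE; lra.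
move=> /le_trans; apply; apply: le_trans (prob_setU_le P mFU (mQT n)) _.
have := le_trans (pQ n (leqnn n)) hn; lra.
Qed.

(** The stopping index [j] is the first one past [q] where the difference is down to [lev om];
    [stopped_prob_le] then applies [one_sided_prob_le] to the [L] steps that follow, of total length
    [1 / c]. Since [om] is fixed by [eps] before the path is seen, the hypothesis quantifies over
    [om] and lets the level depend on it. *)
Lemma stopped_negligible a b a' b' c (q : R) (lev : R -> R) (B : set T) :
  (0 < c)%N -> a' <> b' ->
  (forall (om : R) w, 0 < om -> B w -> exists2 dl : R, 0 < dl & forall L : nat,
    let M := (c * L)%N in (0 < L)%N -> (M%:R)^-1 < dl ->
    exists j, [/\ (j + L <= M)%N, q <= j%:R / M%:R,
      path_diff a b (j%:R / M%:R) w <= lev om,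
      forall j', (j' < j)%N -> q <= j'%:R / M%:R ->
        lev om < path_diff a b (j'%:R / M%:R) w &
      forall m, (m <= L)%N -> path_diff a' b' ((j + m)%:R / M%:R) w -
        path_diff a' b' (j%:R / M%:R) w <= om]) ->
  P.-negligible B.
Proof.
move=> c0 ab' hB; apply: negligible_liminf => eps eps0.
have [rn [om [rn0 om0 hrn]]] := one_sided_prob_le c0 eps0.
pose L n := (rn * n.+1)%N; pose M n := (c * L n)%N.
pose A n j := [set w | (q <= j%:R / (M n)%:R) /\
  (path_diff a b (j%:R / (M n)%:R) w <= lev om /\
  forall j', (j' < j)%N -> q <= j'%:R / (M n)%:R ->
    ~ (path_diff a b (j'%:R / (M n)%:R) w <= lev om))].
pose C n j := [set w | forall m, (m <= L n)%N ->
  path_diff a' b' ((j + m)%:R / (M n)%:R) w -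
  path_diff a' b' (j%:R / (M n)%:R) w <= om].
have mA n j : measurable (A n j : set (sub_space (xi (M n)) (past j))).
  apply: measurable_cst_and_event => _; apply: measurable_and_event.
    by apply: measurable_le_event; [exact: measurable_grid_diff|exact: measurable_cst].
  apply: measurable_forall_event => j'; apply: measurable_imply_event => j'j.
  apply: measurable_imply_event => _; apply: measurable_not_event.
  apply: measurable_le_event; last exact: measurable_cst.
  by apply: measurable_grid_diff; exact: ltnW.
have mC n j : measurable (C n j : set (sub_space (xi (M n)) (future j))).
  apply: measurable_forall_event => m; apply: measurable_imply_event => mL.
  apply: measurable_le_event; last exact: measurable_cst.
  by apply: measurable_grid_diff_incr; [exact: leq_addr|move=> ? i /andP[]].
pose E n := [set w | exists j, (j < (M n).+1 - L n)%N /\ (A n j w /\ C n j w)].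
have mE n : measurable (E n).
  apply: measurable_exists_event => j; apply: measurable_cst_and_event => _.
  by apply: measurable_and_event;
    [exact: sub_space_measurable (mA n j)|exact: sub_space_measurable (mC n j)].
exists E; split=> //.
- move=> n; apply: (@stopped_prob_le _ _ _ P (xi (M n)) (@mxi _) (@xi_indep _)
    past future ((M n).+1 - L n) (A n) (C n)) => //.
  + exact: ltW.
  + by move=> i _; exact: past_future.
  + move=> x y w _ _ [qx [hx fx]] [qy [hy fy]].
    by case: (ltngtP x y) => // xy; [have := fy _ xy qx|have := fx _ xy qy].
  + by move=> j jM; apply: hrn => //; rewrite -/(L n) -/(M n); lia.
  + by move=> w [j [jM AC]]; exists j.
- move=> w Bw; have [dl dl0 h] := hB om w om0 Bw.
  exists (Num.truncn dl^-1) => n nn.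
  have L0 : (0 < L n)%N by rewrite muln_gt0 rn0.
  have hdl : ((M n)%:R)^-1 < dl.
    have M0 : (0 : R) < (M n)%:R by rewrite ltr0n muln_gt0 c0.
    rewrite invf_plt ?posrE//; apply: lt_le_trans (truncnS_gt _) _.
    rewrite ler_nat; apply: (@leq_trans n.+1) => //.
    by rewrite /M /L mulnA leq_pmull// muln_gt0 c0.
  have [j [jM qj hj fj Cj]] := h (L n) L0 hdl.
  exists j; split; first by rewrite -/(M n) in jM; lia.
  split=> //; split=> //; split=> // j' j'j qj'; apply/negP; rewrite -ltNge.
  exact: fj.
Qed.

End oscillation.

(** * Small tubes have positive probability *)

Lemma eventually_all (Q : nat -> nat -> Prop) m :
  (forall a, exists n0, forall n, (n0 <= n)%N -> Q a n) ->
  exists n0, forall n, (n0 <= n)%N -> forall a, (a < m)%N -> Q a n.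
Proof.
move=> h; elim: m => [|m [n1 h1]]; first by exists 0%N.
have [n2 h2] := h m; exists (maxn n1 n2) => n; rewrite geq_max => /andP[n1n n2n] a.
by rewrite ltnS leq_eqVlt => /predU1P[->|am]; [exact: h2|exact: h1].
Qed.

Lemma ltr_inv_nat (R : realType) (e : R) : 0 < e ->
  exists n0, forall n, (n0 <= n)%N -> (n.+1%:R)^-1 < e.
Proof.
move=> e0; exists (Num.truncn e^-1) => n nn.
rewrite invf_plt ?posrE//; apply: lt_le_trans (truncnS_gt _) _.
by rewrite ler_nat.
Qed.

Lemma grid_approx (R : realType) (x : R) M : (0 < M)%N -> 0 <= x <= 1 ->
  exists2 j, (j <= M)%N & j%:R / M%:R <= x < j%:R / M%:R + M%:R^-1.
Proof.
move=> M0 /andP[x0 x1]; have M0R : (0 : R) < M%:R by rewrite ltr0n.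
have xM0 : 0 <= x * M%:R by rewrite mulr_ge0// ltW.
have /andP[j1 j2] := truncn_itv xM0.
exists (Num.truncn (x * M%:R)).
  by rewrite -(ler_nat R); apply: le_trans j1 _; rewrite ler_piMl// ltW.
rewrite ler_pdivrMr// j1/= -[X in _ + X]mul1r -mulrDl ltr_pdivlMr//.
by rewrite -natr1 in j2.
Qed.

Section density.
Context {R : realType} {d : measure_display} {T : measurableType d}.
Variable P : probability T R.
Variables (N : nat -> {RV P >-> R}) (X : nat -> unitI R -> {RV P >-> R}).
Hypotheses (N_normal : forall n, has_normal_law P (N n) 0 1)
  (N_indep : indep_rvs P (fun n : nat => (N n : T -> R)))
  (X_brownian : forall n, standard_brownian_motion P (fun t => (X n t : T -> R)))
  (X_indep : indep_processes P (fun (n : nat) t => (X n t : T -> R)))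
  (NX_indep : indep2 P
     (sigma_gen (fun n : nat => (N n : T -> R)))
     (sigma_gen (fun nt : nat * unitI R => (X nt.1 nt.2 : T -> R)))).

Local Notation path := (path N X).
Local Notation xi := (grid_incr N X).

Let xi_indep M : box_indep P (xi M).
Proof. exact: grid_box_indep. Qed.

Let mxi M a b : measurable_fun setT (xi M a b).
Proof. exact: measurable_grid_incr. Qed.

Let mpast M j m a : (j <= m)%N ->
  measurable_fun (setT : set (sub_space (xi M) (past m))) (path a (j%:R / M%:R)).
Proof.
move=> jm; apply: measurable_grid_path => // i ij;
  by rewrite /past /=; exact: leq_trans jm.
Qed.

Let mfuture M i j k a : (i <= j)%N -> (j <= k)%N ->
  measurable_fun (setT : set (sub_space (xi M) (future i)))
    (fun w => path a (k%:R / M%:R) w - path a (j%:R / M%:R) w).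
Proof.
move=> ij jk; apply: measurable_grid_path_incr => // m /andP[jm _].
by rewrite /future /=; exact: leq_ltn_trans jm.
Qed.

(* Ottaviani's maximal inequality. *)
Lemma max_incr_prob_le M a j k (s u : R) : (j < k)%N -> (k <= M)%N -> 0 < u ->
  s = Num.sqrt ((k - j)%:R / M%:R) -> 8 * s <= u ->
  prob P [set w | exists m, (j <= m <= k)%N /\
    2 * u < `|path a (m%:R / M%:R) w - path a (j%:R / M%:R) w|] <= 8 * s / u.
Proof.
move=> jk kM u0 sE su.
pose D i m w := path a (m%:R / M%:R) w - path a (i%:R / M%:R) w.
have mD i m : measurable_fun setT (D i m).
  by apply: measurable_funB; exact: measurable_path.
have M0 : (0 : R) < M%:R by rewrite ltr0n; lia.
have tail i : (j <= i < k)%N -> prob P [set w | u < `|D i k w|] <= 4 * s / u.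
  move=> /andP[ji ik].
  have := @gauss_tail _ _ _ P (D i k) (Num.sqrt ((k - i)%:R / M%:R)).
  have kiM : (0 : R) < (k - i)%:R / M%:R by rewrite divr_gt0// ltr0n subn_gt0.
  rewrite sqrtr_gt0 kiM => /(_ isT (@grid_path_law _ _ _ P N X X_brownian M a i k ik kM)
    (mD i k) u u0).
  move=> /le_trans; apply.
  rewrite ler_pM2r ?invr_gt0// ler_pM2l// sE ler_wsqrtr// ler_pM2r ?invr_gt0// ler_nat.
  by rewrite leq_sub2l.
(* First passage over [2 * u] at index [m]. If the remaining increment is at most [u], an
   independent event of probability at least 1/2, the final increment still exceeds [u]. *)
pose A m := [set w | (j <= m <= k)%N /\ (2 * u < `|D j m w| /\
  forall m', (m' < m)%N -> (j <= m')%N -> ~ (2 * u < `|D j m' w|))].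
pose B m := [set w | `|D m k w| <= u].
have mgt m m' : (j <= m' <= m)%N ->
    measurable ([set w | 2 * u < `|D j m' w|] : set (sub_space (xi M) (past m))).
  move=> /andP[jm' m'm].
  apply: measurable_lt_event; first exact: measurable_cst.
  apply: measurableT_comp => //; apply: measurable_funB; apply: mpast => //.
  exact: leq_trans m'm.
have mA m : measurable (A m : set (sub_space (xi M) (past m))).
  apply: measurable_cst_and_event => /andP[jm mk]; apply: measurable_and_event.
    by apply: mgt; rewrite jm leqnn.
  apply: measurable_forall_event => m'; apply: measurable_imply_event => m'm.
  apply: measurable_imply_event => jm'; apply: measurable_not_event.
  by apply: mgt; rewrite jm' ltnW.
have mAT m : measurable (A m) by exact: sub_space_measurable (mA m).
have mB m : (m <= k)%N -> measurable (B m : set (sub_space (xi M) (future m))).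
  by move=> mk; apply: measurable_norm_le_event; exact: mfuture.
have mBT m : measurable (B m) by exact: measurable_norm_le_event.
have dA x y w : A x w -> A y w -> x = y.
  move=> [/andP[jx _] [hx fx]] [/andP[jy _] [hy fy]].
  by case: (ltngtP x y) => // xy; [have := fy _ xy jx|have := fx _ xy jy].
have pB m : (j <= m <= k)%N -> 1 / 2 <= prob P (B m).
  move=> /andP[jm]; rewrite leq_eqVlt => /predU1P[->|mk].
    rewrite (_ : B k = setT) ?prob_setT//; first by lra.
    by apply/seteqP; split=> // w _; rewrite /B /D /= subrr normr0 ltW.
  have -> : B m = ~` [set w | u < `|D m k w|].
    by apply/seteqP; split=> w; rewrite /B /=; [move=> h; apply/negP; rewrite -leNgt|
      move=> /negP; rewrite -leNgt].
  have mt : measurable [set w | u < `|D m k w|].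
    by apply: measurable_lt_event; [exact: measurable_cst|exact: measurableT_comp].
  rewrite prob_setC//; have := tail m; rewrite jm mk => /(_ isT).
  have : 4 * s / u <= 1 / 2 by rewrite ler_pdivrMr//; lra.
  by lra.
set E := [set w | _].
have mE : measurable E.
  apply: measurable_exists_event => m; apply: measurable_cst_and_event => _.
  apply: measurable_lt_event; first exact: measurable_cst.
  by apply: measurableT_comp => //; exact: (mD j m).
have h1 : prob P E <= \sum_(m < k.+1) prob P (A m).
  apply: prob_cover_le => // w Ew; have [m [/andP[jm mk] hm] fm] := ex_first Ew.
  exists m => //; split; first by rewrite jm.
  split=> // m' m'm jm' hm'; apply: (fm _ m'm); split=> //.
  by rewrite jm' (leq_trans (ltnW m'm)).
have h2 : \sum_(m < k.+1) prob P (A m `&` B m) <= prob P [set w | u < `|D j k w|].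
  apply: (@prob_disjoint_le _ _ _ P k.+1 (fun m => A m `&` B m)).
  - by apply: measurable_lt_event; [exact: measurable_cst|exact: measurableT_comp].
  - by move=> m _; exact: measurableI.
  - by move=> x y w _ _ [hx _] [hy _]; exact: dA hx hy.
  - move=> m w _ [[_ [h _]] /=]; rewrite /B /= => hB.
    have := ler_normB (D j k w) (D m k w).
    rewrite (_ : D j k w - D m k w = D j m w); last by rewrite /D; ring.
    by lra.
have h3 : \sum_(m < k.+1) prob P (A m) <= 2 * \sum_(m < k.+1) prob P (A m `&` B m).
  rewrite mulr_sumr; apply: ler_sum => m _.
  have [jmk|jmk] := boolP (j <= m <= k)%N; last first.
    rewrite (_ : A m = set0); last first.
      by apply/seteqP; split=> // w [h]; rewrite h in jmk.
    by rewrite set0I /prob measure0 mulr0.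
  have mk : (m <= k)%N by case/andP: jmk.
  rewrite (indep_sub_spaces (@mxi M) (@xi_indep M) (@past_future _) (mA m) (mB m mk)).
  by have := pB m jmk; have := prob_ge0 P (A m); nra.
have := tail j; rewrite leqnn jk => /(_ isT) h4.
have -> : 8 * s / u = 2 * (4 * s / u) by ring.
by lra.
Qed.

Variables (gam : R -> R) (Lc : R).
Hypotheses (Lc0 : 0 <= Lc) (gamL : forall x y, `|gam x - gam y| <= Lc * `|x - y|).

(* The path is steered towards [gam]: over each coarse step of length [1 / M0]
   its increment points against the sign of the current error. *)
Lemma tracking_prob_ge (e : R) : 0 < e -> exists p M0, [/\ 0 < p, (0 < M0)%N &
  forall K a, (0 < K)%N -> p <= prob P [set w | forall j, (j <= M0 * K)%N ->
    `|path a (j%:R / (M0 * K)%:R) w - gam (j%:R / (M0 * K)%:R)| <= 4 * e]].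
Proof.
move=> e0; have Lc0' : 0 <= Lc by [].
have gl0 := @gauss_lower_gt0 R; have gl1 := @gauss_lower_le1 R.
(* [s <= t] will give two things: [16 * s / e <= gauss_lower / 2], which controls the oscillation
   within a coarse step, and [Lc * s ^ 2 <= s], so that the target moves by at most [s] over a
   coarse step, whose length is [s ^ 2]. *)
pose t := Num.min (gauss_lower * e / 32) (Lc + 1)^-1.
have ge0 : 0 < gauss_lower * e by exact: mulr_gt0.
have L1 : 0 < Lc + 1 by exact: ltr_wpDl.
have t0 : 0 < t by rewrite lt_min invr_gt0 L1 divr_gt0.
pose M0 := (Num.truncn (t ^+ 2)^-1).+1.
have M00 : (0 : R) < M0%:R by rewrite ltr0n.
pose s : R := Num.sqrt (M0%:R^-1).
have s0 : 0 < s by rewrite sqrtr_gt0 invr_gt0.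
have s2 : s ^+ 2 = M0%:R^-1 by rewrite sqr_sqrtr// invr_ge0 ltW.
have st : s <= t.
  rewrite -(@ler_pXn2r _ 2) ?nnegrE ?(ltW s0) ?(ltW t0)// s2.
  have t20 : 0 < t ^+ 2 by rewrite exprn_gt0.
  by rewrite invf_ple ?posrE//; apply/ltW; exact: truncnS_gt.
have [s1 sL] : s <= gauss_lower * e / 32 /\ s <= (Lc + 1)^-1.
  by move: st; rewrite le_min => /andP.
have se : 32 * s <= e by nra.
have Ls : Lc * s ^+ 2 <= s.
  have : s * (Lc + 1) <= 1 by rewrite -ler_pdivlMr; [rewrite div1r|lra].
  by rewrite expr2; nra.
(* The interval of radius [e] about [gam 0] lies in [[-r, r]]; its length times the density at [r]
   is [p0]. *)
pose r := `|gam 0| + e.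
pose p0 := e *+ 2 * normal_pdf 0 1 r.
have p00 : 0 < p0.
  rewrite /p0 mulr_gt0 ?mulrn_wgt0// normal_pdfE ?oner_neq0//.
  by rewrite mulr_gt0 ?expR_gt0// normal_peak_gt0 ?oner_neq0.
exists (p0 * (gauss_lower / 2) ^+ M0), M0; split=> //.
  by rewrite mulr_gt0// exprn_gt0// divr_gt0.
move=> K a K0; set M := (M0 * K)%N.
have KR : (0 : R) < K%:R by rewrite ltr0n.
have MR : (0 : R) < M%:R by rewrite ltr0n muln_gt0 K0.
pose F i w := path a ((i * K)%:R / M%:R) w.
pose y i w := F i w - gam ((i * K)%:R / M%:R).
pose mx i := [set w | exists m, (i * K <= m <= i.+1 * K)%N /\
  e < `|path a (m%:R / M%:R) w - path a ((i * K)%:R / M%:R) w|].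
pose G lo hi i := [set w | lo <= F i.+1 w - F i w <= hi] `&` ~` mx i.
(* An increment of size between [s] and [2 * s] against the sign of the error outweighs the motion
   of the target, at most [s], so the error at coarse times stays within [e]. *)
pose A := fix A i : set T := if i is i'.+1 then A i' `&`
  (([set w | 0 <= y i' w] `&` G (- (2 * s)) (- s) i') `|`
   ([set w | y i' w < 0] `&` G s (2 * s) i')) else [set w | `|y 0%N w| <= e].
have iKM i : (i <= M0)%N -> (i * K <= M)%N by move=> iM; rewrite leq_mul2r iM orbT.
have iK i : (i * K < i.+1 * K)%N by rewrite ltn_mul2r K0 /=.
have sE i : s = Num.sqrt ((i.+1 * K - i * K)%:R / M%:R).
  rewrite -mulnBl subSnn mul1n /s /M natrM; congr Num.sqrt; field.
  by rewrite !gt_eqF.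
have mFd S i : (forall b, (i * K < b)%N -> S (a, b)) ->
    measurable_fun (setT : set (sub_space (xi M) S)) (fun w => F i.+1 w - F i w).
  move=> hS; apply: measurable_grid_path_incr => //; first exact: ltnW.
  by move=> b /andP[/hS].
have mitv S i lo hi : (forall b, (i * K < b)%N -> S (a, b)) -> measurable
    ([set w | lo <= F i.+1 w - F i w <= hi] : set (sub_space (xi M) S)).
  move=> hS.
  rewrite (_ : [set w | _] = [set w | lo <= F i.+1 w - F i w] `&`
      [set w | F i.+1 w - F i w <= hi]).
    by apply: measurableI; apply: measurable_le_event;
      (exact: mFd || exact: measurable_cst).
  by apply/seteqP; split=> w /=; [move=> /andP|move=> [-> ->]].
have mmx i : measurable (mx i : set (sub_space (xi M) (future (i * K)))).
  apply: measurable_exists_event => m; apply: measurable_cst_and_event => /andP[im _].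
  apply: measurable_lt_event; first exact: measurable_cst.
  by apply: measurableT_comp => //; exact: mfuture.
have mG lo hi i : measurable (G lo hi i : set (sub_space (xi M) (future (i * K)))).
  by apply: measurableI; [exact: mitv|exact: measurableC].
have mGp lo hi i m : (i.+1 * K <= m)%N ->
    measurable (G lo hi i : set (sub_space (xi M) (past m))).
  move=> im; apply: measurableI.
    rewrite (_ : [set w | _] = [set w | lo <= F i.+1 w - F i w] `&`
        [set w | F i.+1 w - F i w <= hi]).
      by apply: measurableI; apply: measurable_le_event; try exact: measurable_cst;
        apply: measurable_funB; apply: mpast => //; apply: leq_trans im; exact: ltnW.
    by apply/seteqP; split=> w /=; [move=> /andP|move=> [-> ->]].
  apply: measurableC; apply: measurable_exists_event => b.
  apply: measurable_cst_and_event => /andP[_ bi].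
  apply: measurable_lt_event; first exact: measurable_cst.
  apply: measurableT_comp => //; apply: measurable_funB; apply: mpast.
    exact: leq_trans im.
  by apply: leq_trans im; exact: ltnW.
have myp i m : (i * K <= m)%N ->
    measurable_fun (setT : set (sub_space (xi M) (past m))) (y i).
  by move=> im; apply: measurable_funB; [exact: mpast|exact: measurable_cst].
have mA i m : (i * K <= m)%N -> measurable (A i : set (sub_space (xi M) (past m))).
  elim: i m => [|i IH] m im.
    by apply: measurable_norm_le_event; exact: myp.
  have im' : (i * K <= m)%N by apply: leq_trans im; exact: ltnW.
  apply: measurableI; first exact: IH.
  apply: measurableU; apply: measurableI; try exact: mGp.
    by apply: measurable_le_event; [exact: measurable_cst|exact: myp].
  by apply: measurable_lt_event; [exact: myp|exact: measurable_cst].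
have mAT i : measurable (A i) by exact: sub_space_measurable (mA i _ (leqnn _)).
have mGT lo hi i : measurable (G lo hi i) by exact: sub_space_measurable (mG lo hi i).
have pG lo hi i : (i < M0)%N -> hi - lo = s -> - (2 * s) <= lo -> hi <= 2 * s ->
    gauss_lower / 2 <= prob P (G lo hi i).
  move=> iM hl l1 h1.
  have lawF : has_normal_law P (fun w => F i.+1 w - F i w) 0 s.
    by rewrite (sE i); apply: grid_path_law => //; exact: iKM.
  have lh : lo <= hi by lra.
  have := gauss_itv_ge s0 lawF lh l1 h1; rewrite hl divff ?gt_eqF// mulr1 => b1.
  have e20 : 0 < e / 2 by rewrite divr_gt0.
  have se2 : 8 * s <= e / 2 by lra.
  have := @max_incr_prob_le M a _ _ s (e / 2) (iK i) (iKM _ iM) e20 (sE i) se2.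
  rewrite (_ : 2 * (e / 2) = e); last by field.
  rewrite -/(mx i) (_ : 8 * s / (e / 2) = 16 * s / e); last by field; rewrite gt_eqF.
  have : 16 * s / e <= gauss_lower / 2 by rewrite ler_pdivrMr//; lra.
  move=> b2 b3.
  have mI : measurable [set w | lo <= F i.+1 w - F i w <= hi].
    by apply: sub_space_measurable (mitv (future (i * K)) i lo hi _).
  have mm : measurable (mx i) by exact: sub_space_measurable (mmx i).
  have : prob P [set w | lo <= F i.+1 w - F i w <= hi] <=
      prob P (G lo hi i `|` mx i).
    apply: prob_le => //; first exact: measurableU.
    by move=> w h; have [|] := pselect (mx i w); [right|left].
  by have := prob_setU_le P (mGT lo hi i) mm; lra.
have pA i : (i <= M0)%N -> p0 * (gauss_lower / 2) ^+ i <= prob P (A i).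
  elim: i => [|i IH] iM.
    rewrite expr0 mulr1 /A.
    have law0 : has_normal_law P (path a (0%:R / M%:R)) 0 1 by exact: path0_law.
    have -> : [set w | `|y 0%N w| <= e] = [set w | gam 0 - e <=
        path a (0%:R / M%:R) w <= gam 0 + e].
      apply/seteqP; split=> w; rewrite /y /F mul0n mul0r /= ler_norml => /andP[? ?];
        apply/andP; split; lra.
    have := @gauss_itv_pdf_ge _ _ _ P _ 1 ltr01 law0 r (gam 0 - e) (gam 0 + e).
    rewrite (_ : gam 0 + e - (gam 0 - e) = e *+ 2); last by ring.
    have := ler_norm (gam 0); have := ler_norm (- gam 0); rewrite normrN /r => h1 h2.
    by apply; lra.
  have {}IH := IH (ltnW iM).
  (* Splitting by the sign of the error gives two events of the past. Each meets a future event with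
     the same lower bound [gauss_lower / 2], so the two parts recombine to [A i]. *)
  pose A1 := A i `&` [set w | 0 <= y i w]; pose A2 := A i `&` [set w | y i w < 0].
  have mA1 : measurable (A1 : set (sub_space (xi M) (past (i * K)))).
    apply: measurableI; first exact: mA.
    by apply: measurable_le_event; [exact: measurable_cst|exact: myp].
  have mA2 : measurable (A2 : set (sub_space (xi M) (past (i * K)))).
    apply: measurableI; first exact: mA.
    by apply: measurable_lt_event; [exact: myp|exact: measurable_cst].
  have mA1T : measurable A1 by exact: sub_space_measurable mA1.
  have mA2T : measurable A2 by exact: sub_space_measurable mA2.
  have -> : A i.+1 = (A1 `&` G (- (2 * s)) (- s) i) `|` (A2 `&` G s (2 * s) i).
    by rewrite /= setIUr !setIA.
  rewrite prob_setU; [|exact: measurableI|exact: measurableI|]; last first.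
    by apply/disj_setPS => w [[[_ /= h1] _] [[_ /= h2] _]]; move: h1; rewrite leNgt h2.
  have AE : prob P (A i) = prob P A1 + prob P A2.
    rewrite -prob_setU//; last first.
      by apply/disj_setPS => w [[_ /= h1] [_ /= h2]]; move: h1; rewrite leNgt h2.
    rewrite /A1 /A2 -setIUr; congr prob; rewrite (_ : _ `|` _ = setT) ?setIT//.
    by apply/seteqP; split=> // w _ /=; case: (leP 0 (y i w)); [left|right].
  rewrite !(indep_sub_spaces (@mxi M) (@xi_indep M) (@past_future (i * K)) _ (mG _ _ _))//.
  have g1 : gauss_lower / 2 <= prob P (G (- (2 * s)) (- s) i) by apply: pG => //; lra.
  have g2 : gauss_lower / 2 <= prob P (G s (2 * s) i) by apply: pG => //; lra.
  have a1 := prob_ge0 P A1; have a2 := prob_ge0 P A2.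
  rewrite exprSr mulrA.
  apply: (@le_trans _ _ ((prob P A1 + prob P A2) * (gauss_lower / 2))).
    by rewrite -AE ler_wpM2r// divr_ge0// ltW.
  by rewrite mulrDl lerD// ler_wpM2l.
have gamstep i m : (i * K <= m <= i.+1 * K)%N ->
    `|gam (m%:R / M%:R) - gam ((i * K)%:R / M%:R)| <= s.
  move=> /andP[im mi]; apply: le_trans (gamL _ _) _; apply: le_trans Ls.
  rewrite ler_wpM2l// -mulrBl ger0_norm; last first.
    by rewrite divr_ge0 ?(ltW MR)// subr_ge0 ler_nat.
  rewrite s2 ler_pdivrMr// (_ : M0%:R^-1 * M%:R = K%:R); last first.
    by rewrite /M natrM mulKf// gt_eqF.
  rewrite -natrB// ler_nat.
  by rewrite leq_subLR -mulSnr.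
(* Between coarse times the error is at most its size [e] at the last coarse time, plus the
   oscillation [e], plus [s] for the target. *)
have Ay i w : A i w -> `|y i w| <= e /\ forall j, (j <= i * K)%N ->
    `|path a (j%:R / M%:R) w - gam (j%:R / M%:R)| <= 4 * e.
  elim: i => [|i IH].
    move=> h; split=> // j; rewrite mul0n leqn0 => /eqP->.
    have h' : `|y 0%N w| <= e := h; rewrite /y /F mul0n in h'.
    by apply: le_trans h' _; lra.
  move=> [/IH[yi pi] hG].
  have {hG} [dF nmx] : ((0 <= y i w /\ - (2 * s) <= F i.+1 w - F i w <= - s) \/
      (y i w < 0 /\ s <= F i.+1 w - F i w <= 2 * s)) /\ ~ mx i w.
    by case: hG => -[h1 [h2 h3]]; split=> //; [left|right].
  split.
    have := gamstep i (i.+1 * K)%N; rewrite leqnn ltnW// => /(_ isT).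
    move: yi dF; rewrite /y !ler_norml => /andP[? ?] dF /andP[? ?].
    case: dF => -[h1 /andP[? ?]]; apply/andP; split; lra.
  move=> j ji1; have [ji|ij] := leqP j (i * K); first exact: pi.
  have hj : `|path a (j%:R / M%:R) w - F i w| <= e.
    by rewrite leNgt; apply/negP => h; apply: nmx; exists j; rewrite ltnW.
  have := gamstep i j; rewrite ji1 ltnW// => /(_ isT).
  move: yi hj; rewrite /y !ler_norml => /andP[? ?] /andP[? ?] /andP[? ?].
  by apply/andP; split; lra.
apply: le_trans (pA M0 (leqnn _)) _; apply: prob_le => //.
  apply: measurable_forall_event => j; apply: measurable_imply_event => _.
  apply: measurable_norm_le_event; apply: measurable_funB; last exact: measurable_cst.
  exact: measurable_path.
by move=> w /Ay[].
Qed.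

Lemma continuous_lipschitz : continuous gam.
Proof.
move=> x; apply/cvgrPdist_le => e e0.
have L1 : 0 < Lc + 1 by exact: ltr_wpDl.
exists (e / (Lc + 1)) => /=; first by rewrite divr_gt0.
move=> y /= /ltW; rewrite ler_pdivlMr// => h; apply: le_trans (gamL _ _) _.
by apply: le_trans h; rewrite mulrC ler_wpM2l// lerDl.
Qed.

(** On a given grid the paths behave independently, so the first [m] all leave the tube with
    probability at most [(1 - p) ^ m], uniformly in the mesh. By continuity, a path outside the tube
    at some time is seen outside on every fine enough grid. *)
Lemma not_approximated_negligible (e : R) : 0 < e ->
  P.-negligible [set w | forall a, exists2 x : R, 0 <= x <= 1 &
    4 * e < `|path a x w - gam x|].
Proof.
move=> e0; have [p [M0 [p0 M00 hp]]] := tracking_prob_ge e0.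
apply: negligible_liminf => eps eps0.
pose M n := (M0 * n.+1)%N.
pose E n a := [set w | forall j, (j <= M n)%N ->
  `|path a (j%:R / (M n)%:R) w - gam (j%:R / (M n)%:R)| <= 4 * e].
have mE n a S : (forall b, S (a, b)) ->
    measurable (E n a : set (sub_space (xi (M n)) S)).
  move=> Sa; apply: measurable_forall_event => j; apply: measurable_imply_event => _.
  apply: measurable_norm_le_event; apply: measurable_funB; last exact: measurable_cst.
  exact: measurable_grid_path.
have pE n a : p <= prob P (E n a) by exact: hp.
have mET n a : measurable (E n a).
  by apply: sub_space_measurable (mE n a setT _).
have p1 : p <= 1 by apply: le_trans (pE 0%N 0%N) _; exact: prob_le1.
have [m hm] : exists m, (1 - p) ^+ m <= eps by apply: expr_small => //; lra.
pose B n k := [set w | forall a, (a < k)%N -> ~ E n a w].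
have mB n k : measurable (B n k : set (sub_space (xi (M n)) [set x | (x.1 < k)%N])).
  apply: measurable_forall_event => a; apply: measurable_imply_event => ak.
  by apply: measurable_not_event; apply: mE.
have mBT n k : measurable (B n k) by exact: sub_space_measurable (mB n k).
have pB n k : prob P (B n k) <= (1 - p) ^+ k.
  elim: k => [|k IH]; first by rewrite expr0 prob_le1.
  have -> : B n k.+1 = B n k `&` ~` E n k.
    apply/seteqP; split=> w.
      by move=> h; split=> [a ak|]; apply: h => //; exact: ltnW.
    by move=> [h1 h2] a; rewrite ltnS leq_eqVlt => /predU1P[->//|]; exact: h1.
  have mEk : measurable (~` E n k : set (sub_space (xi (M n)) [set x | x.1 = k])).
    by apply: measurableC; exact: mE.
  rewrite (indep_sub_spaces (@mxi _) (@xi_indep _) _ (mB n k) mEk) ?exprSr; last first.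
    by apply/seteqP; split=> // -[x z] /= [] h1 h2; move: h1; rewrite h2 ltnn.
  by apply: ler_pM; rewrite ?prob_ge0// prob_setC//; have := pE n k; lra.
exists (fun n => B n m); split=> //; first by move=> n; exact: le_trans (pB n m) hm.
move=> w hw.
(* Only [m] paths are involved, so their thresholds have a maximum. *)
suff : forall a, exists n0, forall n, (n0 <= n)%N -> ~ E n a w by exact: eventually_all.
move=> a; have [x x01 hx] := hw a.
pose h x := path a x w - gam x.
have ch : continuous h.
  by move=> z; apply: cvgB; [exact: continuous_path|exact: continuous_lipschitz].
have e10 : 0 < (`|h x| - 4 * e) / 2 by rewrite divr_gt0// subr_gt0.
have [dl dl0 hdl] := continuous_distP x ch e10.
have [n0 hn0] := ltr_inv_nat dl0.
exists n0 => n n0n En.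
have Mn0 : (0 < M n)%N by rewrite muln_gt0 M00.
have [j jM /andP[j1 j2]] := grid_approx Mn0 x01.
have Minv : ((M n)%:R)^-1 <= (n.+1%:R)^-1 :> R.
  by rewrite lef_pV2 ?posrE ?ltr0n// ler_nat leq_pmull.
have hn1 := hn0 n n0n.
have hd : `|x - j%:R / (M n)%:R| < dl.
  rewrite ger0_norm ?subr_ge0// ltrBlDl; apply: lt_trans j2 _.
  by rewrite ltrD2l; exact: le_lt_trans Minv hn1.
have := hdl _ hd.
have := En j jM; rewrite -/(h _) => h1.
have := ler_normB (h (j%:R / (M n)%:R)) (h (j%:R / (M n)%:R) - h x).
rewrite (_ : h (j%:R / (M n)%:R) - (h (j%:R / (M n)%:R) - h x) = h x); last by ring.
by rewrite -/(h x) in hx; lra.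
Qed.

End density.

(** * Deterministic crossings and Lipschitz targets *)

Section crossing.
Context {R : realType}.
Implicit Types (f g : R -> R) (k q x : R).

(** The stretch [2 / c] after [x] accommodates grid steps of total length [1 / c] that start up to
    one mesh after [x], the mesh being itself at most [1 / c]. *)
Definition local_min_at f k q (c : nat) : Prop := exists x : R,
  [/\ 0 <= q <= x, x + 2 / c%:R <= 1, f x = k &
      forall y : R, q <= y <= x + 2 / c%:R -> k <= f y].

Definition single_descent f k q (c : nat) : Prop := exists x : R,
  [/\ 0 <= q <= x, x + 2 / c%:R <= 1, f x = k,
      forall y : R, q <= y < x -> k < f y &
      forall y : R, x <= y <= x + 2 / c%:R -> f y <= k].

Definition regular_level f k : Prop := forall (q : rat) c,
  ~ local_min_at f k (ratr q) c.+1 /\ ~ single_descent f k (ratr q) c.+1.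

(** If [f] stays above [k] on the right as well, [x] is a local minimum. If it stays below, either
    [f] takes the value [k] at some earlier [y], which is then a local minimum, or [f > k] just
    before [x] and [x] is a single descent. *)
Let one_sided_contra f k x (e : R) : 0 < x < 1 -> f x = k -> 0 < e -> regular_level f k ->
  (forall y : R, x - e < y < x -> k <= f y) ->
  (forall y, x < y < x + e -> k <= f y) \/ (forall y, x < y < x + e -> f y <= k) ->
  False.
Proof.
move=> /andP[x0 x1] fx e0 reg left right.
have lo : Num.max 0 (x - e) < x by rewrite gt_max x0 gtrBl e0.
have [q /[!in_itv]/= /andP[]] := rat_in_itvoo lo.
rewrite gt_max => /andP[q0 qe] qx.
have small (z : R) : 0 < z -> exists (c : nat) (t : R), t = 2 / c.+1%:R /\ 0 < t < z.
  move=> z0; have z20 : 0 < z / 2 by rewrite divr_gt0.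
  have [c hc] := ltr_inv_nat z20; exists c, (2 / c.+1%:R); split=> //.
  have := hc c (leqnn c); rewrite ltr_pdivlMr// mulrC => ->.
  by rewrite divr_gt0 ?ltr0n.
have [c [t [tE]]] : exists (c : nat) (t : R), t = 2 / c.+1%:R /\ 0 < t < Num.min e (1 - x).
  by apply: small; rewrite lt_min e0 subr_gt0.
rewrite lt_min => /and3P[t0 ce cx].
have nonneg y : ratr q <= y <= x -> k <= f y.
  move=> /andP[qy]; rewrite le_eqVlt => /predU1P[->|yx]; first by rewrite fx.
  by apply: left; rewrite yx (lt_le_trans qe).
case: right => right.
  apply: (proj1 (reg q c)); exists x; rewrite -tE; split=> //; first by rewrite !ltW.
    by lra.
  move=> y /andP[qy yc]; have [yx|xy] := leP y x; first by apply: nonneg; rewrite qy.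
  by apply: right; rewrite xy; lra.
have pos y : ratr q < y < x -> k < f y.
  move=> /andP[qy yx]; rewrite lt_neqAle nonneg ?(ltW qy) ?(ltW yx)// andbT.
  apply/eqP => fy; have yx0 : 0 < x - y by rewrite subr_gt0.
  have [c' [t' [tE' /andP[t0' ct']]]] := small _ yx0.
  apply: (proj1 (reg q c')); exists y; rewrite -tE'; split=> //; first by rewrite !ltW.
    by lra.
  by move=> z /andP[qz zy]; apply: nonneg; rewrite qz; lra.
(* [pos] holds strictly after [q] only, whereas [single_descent] includes its left end; a second
   rational is inserted. *)
have [q2 /[!in_itv]/= /andP[qq2 q2x]] := rat_in_itvoo qx.
apply: (proj2 (reg q2 c)); exists x; rewrite -tE; split=> //.
- by rewrite (ltW q2x) andbT ltW// (lt_trans q0).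
- by lra.
- by move=> y /andP[qy yx]; apply: pos; rewrite yx (lt_le_trans qq2).
- move=> y /andP[]; rewrite le_eqVlt => /predU1P[<-|xy] yc; first by rewrite fx.
  by apply: right; rewrite xy; lra.
Qed.

(** Failure on both sides gives [f - k] a constant sign on each side. Passing to [-f] if necessary,
    the left sign is nonnegative, and [one_sided_contra] covers both signs on the right. The value
    true of [sg] stands for the left side. *)
Lemma crossing_oscillates f k x : 0 < x < 1 -> f x = k ->
  regular_level f k -> regular_level (fun y => - f y) (- k) ->
  exists sg : bool, forall e : R, 0 < e ->
    (exists2 y : R, 0 < y < e & f (if sg then x - y else x + y) < k) /\
    (exists2 y : R, 0 < y < e & k < f (if sg then x - y else x + y)).
Proof.
move=> x01 fx reg regN; apply: contrapT => nosc.
have side (sg : bool) : exists2 e : R, 0 < e &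
    (forall y, 0 < y < e -> k <= f (if sg then x - y else x + y)) \/
    (forall y, 0 < y < e -> f (if sg then x - y else x + y) <= k).
  apply: contrapT => h; apply: nosc; exists sg => e e0; apply: contrapT => h'.
  apply: h; exists e => //; case: (pselect (exists2 y : R, 0 < y < e &
    f (if sg then x - y else x + y) < k)) => [h1|h1].
    right=> y ye; rewrite leNgt; apply/negP => fy; apply: h'; split=> //.
    by exists y.
  by left=> y ye; rewrite leNgt; apply/negP => fy; apply: h1; exists y.
have [e1 e10 h1] := side true; have [e2 e20 h2] := side false.
pose e := Num.min e1 e2.
have e0 : 0 < e by rewrite lt_min e10.
have [ee1 ee2] : e <= e1 /\ e <= e2 by rewrite !ge_min !lexx orbT.
have L y : x - e < y < x -> 0 < x - y < e1 by move=> /andP[? ?]; lra.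
have Rr y : x < y < x + e -> 0 < y - x < e2 by move=> /andP[? ?]; lra.
have xL y : x - (x - y) = y by ring.
have xR y : x + (y - x) = y by ring.
case: h1 => h1.
  apply: (@one_sided_contra f k x e) => //.
    by move=> y /L/h1; rewrite xL.
  by case: h2 => h2; [left|right] => y /Rr/h2; rewrite xR.
apply: (@one_sided_contra (fun y => - f y) (- k) x e) => //.
- by rewrite fx.
- by move=> y /L/h1; rewrite xL lerN2.
- by case: h2 => h2; [right|left] => y /Rr/h2; rewrite xR lerN2.
Qed.

Lemma decreasing_choice (Q : nat -> R -> Prop) (e : R) : 0 < e ->
  (forall n (z : R), 0 < z -> exists2 y : R, 0 < y < z & Q n y) ->
  exists v : nat -> R, [/\ forall n, 0 < v n < e, forall n, v n < n.+1%:R^-1,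
    forall n, v n.+1 <= v n & forall n, Q n (v n)].
Proof.
move=> e0 hQ.
have h n (z : R) : {y : R | 0 < z -> [/\ 0 < y, y < z, y < n.+1%:R^-1 & Q n y]}.
  apply: cid; case: (pselect (0 < z)) => z0; last by exists 0.
  have z1 : 0 < Num.min z n.+1%:R^-1 by rewrite lt_min z0 invr_gt0 ltr0n.
  by have [y] := hQ n _ z1; rewrite lt_min => /and3P[y0 yz yn] Qy; exists y.
pose v := fix v n := if n is m.+1 then sval (h m.+1 (v m)) else sval (h 0%N e).
have v0 n : 0 < v n.
  elim: n => [|n IH] /=; first by case: (h 0%N e) => y /= /(_ e0)[].
  by case: (h n.+1 (v n)) => y /= /(_ IH)[].
have hv n : [/\ v n.+1 < v n, v n.+1 < n.+2%:R^-1 & Q n.+1 (v n.+1)].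
  by rewrite [v n.+1]/=; case: (h n.+1 (v n)) => y /= /(_ (v0 n))[].
have h0 : [/\ v 0%N < e, v 0%N < 1%:R^-1 & Q 0%N (v 0%N)].
  by rewrite /=; case: (h 0%N e) => y /= /(_ e0)[].
exists v; split.
- move=> n; rewrite v0/=; elim: n => [|n IH]; first by case: h0.
  by apply: lt_trans IH; case: (hv n).
- by case=> [|n]; [case: h0|case: (hv n)].
- by move=> n; apply: ltW; case: (hv n).
- by case=> [|n]; [case: h0|case: (hv n)].
Qed.

Lemma cvg_clip_seq (x : R) (v : nat -> R) (sg : bool) : 0 <= x <= 1 ->
  (forall n, 0 < v n) -> (forall n, v n < n.+1%:R^-1) ->
  clip (if sg then x - v n else x + v n) @[n --> \oo] --> clip x.
Proof.
move=> x01 v0 v1.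
apply: (@cvg_comp _ _ _ (fun n => if sg then x - v n else x + v n) clip _ (nbhs x));
  last exact: continuous_clip.
apply/cvgrPdist_lt => e e0; have [n0 hn0] := ltr_inv_nat e0.
exists n0 => // n /= n0n; have := hn0 n n0n; have := v1 n; have := v0 n.
case: sg => vn vn1 ne.
  rewrite (_ : x - (x - v n) = v n); last by ring.
  by rewrite gtr0_norm//; exact: lt_trans vn1 ne.
rewrite (_ : x - (x + v n) = - v n); last by ring.
by rewrite normrN gtr0_norm//; exact: lt_trans vn1 ne.
Qed.

Lemma floor_eq_near f (x : R) : continuous f -> f x <> (Num.floor (f x))%:~R ->
  exists2 e : R, 0 < e & forall y : R, `|x - y| < e -> Num.floor (f y) = Num.floor (f x).
Proof.
move=> cf fx; have /andP[f1 f2] := floor_itv (f x).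
have {}f1 : (Num.floor (f x))%:~R < f x by rewrite lt_neqAle f1 andbT eq_sym; apply/eqP.
pose z := Num.min (f x - (Num.floor (f x))%:~R) ((Num.floor (f x) + 1)%:~R - f x).
have z0 : 0 < z / 2 by rewrite divr_gt0// lt_min !subr_gt0 f1.
have [e e0 he] := continuous_distP x cf z0; exists e => // y /he.
have [z1 z2] : z <= f x - (Num.floor (f x))%:~R /\
    z <= (Num.floor (f x) + 1)%:~R - f x by rewrite !ge_min !lexx orbT.
rewrite ler_norml => /andP[h1 h2]; apply: floor_def.
by apply/andP; split; lra.
Qed.

Lemma fracpart_eq (u v : R) : fracpart u = fracpart v ->
  u - v = (Num.floor u - Num.floor v)%:~R.
Proof.
rewrite /fracpart rmorphB/= => h.
have : u - v = (u - (Num.floor u)%:~R) - (v - (Num.floor v)%:~R) +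
  ((Num.floor u)%:~R - (Num.floor v)%:~R) by ring.
by rewrite h subrr add0r.
Qed.

Lemma alternates_of_crossing f g (x : unitI R) :
  continuous f -> continuous g -> 0 < set_val x < 1 ->
  fracpart (f (set_val x)) = fracpart (g (set_val x)) ->
  ~ (exists z1 z2 : int, f (set_val x) = z1%:~R /\ g (set_val x) = z2%:~R) ->
  (forall z : int, regular_level (fun y => f y - g y) z%:~R) ->
  (forall z : int, regular_level (fun y => g y - f y) z%:~R) ->
  alternates_at (fun t => f (set_val t)) (fun t => g (set_val t)) x.
Proof.
move=> cf cg; set x0 := set_val x => x01 fg nint reg1 reg2.
have fgE := fracpart_eq fg.
set kz := Num.floor (f x0) - Num.floor (g x0) in fgE.
(* If one value is an integer, its fractional part is 0 and the other value is an integer as well,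
   which is excluded. *)
have nf : f x0 <> (Num.floor (f x0))%:~R.
  move=> fE; apply: nint; exists (Num.floor (f x0)), (Num.floor (g x0)); split=> //.
  by move: fg; rewrite /fracpart -fE subrr => /esym/eqP; rewrite subr_eq0 => /eqP.
have ng : g x0 <> (Num.floor (g x0))%:~R.
  move=> gE; apply: nint; exists (Num.floor (f x0)), (Num.floor (g x0)); split=> //.
  by move: fg; rewrite /fracpart -gE subrr => /eqP; rewrite subr_eq0 => /eqP.
have [e1 e10 h1] := floor_eq_near cf nf.
have [e2 e20 h2] := floor_eq_near cg ng.
have /andP[x0gt x0lt] := x01.
have reg2' : regular_level (fun y => - (f y - g y)) (- kz%:~R).
  rewrite -rmorphN/= (_ : (fun y => - _) = fun y => g y - f y); first exact: reg2.
  by apply/funext => y; ring.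
have [sg osc] := @crossing_oscillates _ _ x0 x01 fgE (reg1 kz) reg2'.
pose pt y := if sg then x0 - y else x0 + y.
(* Within distance [e] both floors are constant and the points stay in [[0, 1]], where [clip]
   changes nothing. *)
pose e := Num.min (Num.min e1 e2) (Num.min x0 (1 - x0)).
have e0 : 0 < e by rewrite !lt_min e10 e20 x0gt subr_gt0.
(* Even terms lie below the level and odd ones above, the order prescribed by [alternates_at]. *)
pose Q n y := if odd n then kz%:~R < f (pt y) - g (pt y)
  else f (pt y) - g (pt y) < kz%:~R.
have hQ n (z : R) : 0 < z -> exists2 y : R, 0 < y < z & Q n y.
  by move=> z0; have [below above] := osc z z0; rewrite /Q; case: (odd n).
have [v [ve v1 vS vQ]] := decreasing_choice e0 hQ.
have v0 n : 0 < v n by case/andP: (ve n).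
have v2 n : [/\ v n < e1, v n < e2, v n < x0 & v n < 1 - x0].
  by have /andP[_] := ve n; rewrite !lt_min => /andP[/andP[? ?] /andP[? ?]].
have vmono i j : (i <= j)%N -> v j <= v i.
  by move=> ij; apply: (nonincreasing_seqP v).1 => // n; exact: vS.
have ptE n : set_val (clip (pt (v n))) = pt (v n).
  by apply: clipE; rewrite /pt; have [? ? ? ?] := v2 n; have := v0 n;
    case: (sg) => ?; apply/andP; split; lra.
have dist n : `|x0 - pt (v n)| = v n.
  rewrite /pt; case: (sg).
    by rewrite (_ : x0 - _ = v n) ?gtr0_norm//; ring.
  by rewrite (_ : x0 - _ = - v n) ?normrN ?gtr0_norm//; ring.
have fr n : fracpart (f (pt (v n))) - fracpart (g (pt (v n))) =
    f (pt (v n)) - g (pt (v n)) - kz%:~R.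
  have [? ? _ _] := v2 n.
  by rewrite /fracpart h1 ?dist// h2 ?dist// /kz rmorphB/=; ring.
exists (fun n => clip (pt (v n))).
  split; last first.
    rewrite -[X in _ --> X]clipK; apply: cvg_clip_seq => //.
    by rewrite -/x0 !ltW.
  have ptE' := ptE; rewrite /pt in ptE' *.
  case: (sg) ptE' => ptE'; [left|right] => i j /vmono vij; rewrite /comp !ptE'.
    by rewrite lerD2l lerN2.
  by rewrite lerD2l.
have frlt n : (fracpart (f (pt (v n))) < fracpart (g (pt (v n)))) =
    (f (pt (v n)) - g (pt (v n)) < kz%:~R) by rewrite -subr_lt0 fr subr_lt0.
have frgt n : (fracpart (g (pt (v n))) < fracpart (f (pt (v n)))) =
    (kz%:~R < f (pt (v n)) - g (pt (v n))) by rewrite -subr_gt0 fr subr_gt0.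
move=> n; cbv beta; rewrite !ptE frlt frgt.
have := vQ (2 * n)%N; have := vQ (2 * n).+1.
by rewrite /Q /= mul2n odd_double.
Qed.

End crossing.

(** * A countable family of Lipschitz functions, dense on [[0, 1]] *)

Section lipschitz_family.
Context {R : realType}.

Definition cone (L : nat) (p : rat * rat) (x : R) : R :=
  ratr p.1 + L%:R * `|x - ratr p.2|.

(** The head [p0] keeps the family of cones nonempty; rational apexes and natural slopes make the
    parameters countable. *)
Definition cone_min (L : nat) (p0 : rat * rat) (s : seq (rat * rat)) (x : R) : R :=
  foldr (fun p m => Num.min (cone L p x) m) (cone L p0 x) s.

Lemma cone_min_le L p0 s p x : p \in p0 :: s -> cone_min L p0 s x <= cone L p x.
Proof.
elim: s => [|p1 s IH] /=; first by rewrite inE => /eqP->.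
rewrite !inE ge_min => /or3P[/eqP pE|/eqP->|ps].
- by rewrite IH ?orbT// pE inE eqxx.
- by rewrite lexx.
- by rewrite IH ?orbT// inE ps orbT.
Qed.

Lemma le_cone_min L p0 s x (r : R) :
  (forall p, p \in p0 :: s -> r <= cone L p x) -> r <= cone_min L p0 s x.
Proof.
elim: s => [|p1 s IH] h /=; first by apply: h; rewrite inE.
rewrite le_min h ?inE ?eqxx ?orbT//=; apply: IH => p ps; apply: h.
by move: ps; rewrite !inE => /orP[->|->]; rewrite ?orbT.
Qed.

Lemma cone_lipschitz L p x y : `|cone L p x - cone L p y| <= L%:R * `|x - y|.
Proof.
rewrite /cone opprD addrACA subrr add0r -mulrBr normrM ger0_norm// ler_wpM2l//.
apply: le_trans (ler_dist_dist _ _) _.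
by rewrite (_ : x - ratr p.2 - (y - ratr p.2) = x - y)//; ring.
Qed.

Lemma cone_min_lipschitz L p0 s x y :
  `|cone_min L p0 s x - cone_min L p0 s y| <= L%:R * `|x - y|.
Proof.
elim: s => [|p s IH] /=; first exact: cone_lipschitz.
have := cone_lipschitz L p x y; move: IH; rewrite !ler_norml.
move=> /andP[? ?] /andP[? ?]; apply/andP; split;
  by case: (leP (cone L p x) (cone_min L p0 s x)) => ?;
     case: (leP (cone L p y) (cone_min L p0 s y)) => ?; lra.
Qed.

(** Around each point the property holds on a neighbourhood for all large [n]; compactness, in its
    near-covering form, makes [n] uniform. One [n] serves both as bound and as inverse modulus of
    continuity. *)
Lemma continuous_unif_bounded (h : R -> R) (e : R) : continuous h -> 0 < e ->
  exists n : nat, forall x : R, 0 <= x <= 1 ->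
    `|h x| <= n%:R /\ forall y : R, `|x - y| < n.+1%:R^-1 -> `|h x - h y| <= e.
Proof.
move=> ch e0.
pose Q n (x : R) := `|h x| <= n%:R /\
  forall y : R, `|x - y| < n.+1%:R^-1 -> `|h x - h y| <= e.
have key (x : R) : exists (dl : R) n0, 0 < dl /\
    forall x' : R, `|x - x'| < dl -> forall n, (n0 <= n)%N -> Q n x'.
  have e20 : 0 < e / 2 by rewrite divr_gt0.
  have [dl dl0 hdl] := continuous_distP x ch e20.
  have dl20 : 0 < dl / 2 by rewrite divr_gt0.
  have [n0 hn0] := ltr_inv_nat dl20.
  pose n1 := (Num.truncn (`|h x| + e)).+1.
  exists (dl / 2), (maxn n0 n1); split=> // x' bx n.
  rewrite geq_max => /andP[n0n n1n].
  have hx' : `|h x' - h x| <= e / 2 by apply: hdl; lra.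
  split.
    have nn : `|h x| + e <= n%:R.
      by apply: le_trans (ltW (truncnS_gt _)) _; rewrite ler_nat.
    have := ler_normD (h x' - h x) (h x); rewrite subrK; lra.
  move=> y yx'; have := hn0 n n0n => hn1.
  have hy : `|h y - h x| <= e / 2.
    apply: hdl; have tri := ler_normD (x - x') (x' - y).
    have xyE : x - x' + (x' - y) = x - y by ring.
    by rewrite xyE in tri; have yx2 := lt_trans yx' hn1; lra.
  have tri := ler_normB (h x' - h x) (h y - h x).
  have hE : h x' - h x - (h y - h x) = h x' - h y by ring.
  by rewrite hE in tri; lra.
have := (compact_near_coveringP _).1 (@segment_compact R 0 1) nat \oo Q.
case=> [x _|n _ hn]; last first.
  by exists n => x x01; apply: (hn n (leqnn n)); rewrite /= in_itv.
have [dl [n0 [dl0 hQ]]] := key x.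
exists (ball x dl, [set n | (n0 <= n)%N]).
  by split; [exact: nbhsx_ballx|exists n0].
by move=> [x' n] /= [bx n0n]; exact: hQ.
Qed.

(** A discrete form of the Lipschitz regularization [inf_y (h y + L |x - y|)]. Apexes near [x] are
    not lower than [h x - 2 * e], and far cones have already risen by as much as [h] can vary; the
    cone at the nearest grid point on the left gives the upper bound. *)
Lemma cone_min_dense (h : R -> R) (e : R) : continuous h -> 0 < e ->
  exists L p0 s, forall x : R, 0 <= x <= 1 -> `|cone_min L p0 s x - h x| <= 3 * e.
Proof.
move=> ch e0; have [n hn] := continuous_unif_bounded ch e0.
(* At distance [1 / (n + 1)] a cone of slope [L] has risen by [2 * n], twice the bound on [|h|]. *)
pose L := (2 * n * n.+1)%N.
have [m0 hm0] : exists m0 : nat, L%:R / m0.+1%:R < e /\ (m0.+1%:R)^-1 < (n.+1%:R)^-1 :> R.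
  have z0 : 0 < Num.min (e / L.+1%:R) (n.+1%:R)^-1 :> R.
    by rewrite lt_min divr_gt0 ?invr_gt0 ?ltr0n.
  have [m1 hm1] := ltr_inv_nat z0; exists m1; have := hm1 m1 (leqnn _).
  rewrite lt_min => /andP[a1 a2]; split=> //.
  have L0 : (0 : R) < L.+1%:R by rewrite ltr0n.
  move: a1; rewrite ltr_pdivlMr// mulrC; apply: le_lt_trans.
  by rewrite ler_wpM2r ?invr_ge0// ler_nat.
pose m := m0.+1; have mR : (0 : R) < m%:R by rewrite ltr0n.
have hv j : {v : rat | `|ratr v - h (j%:R / m%:R)| < e}.
  apply: cid; have hlt : h (j%:R / m%:R) - e < h (j%:R / m%:R) + e by lra.
  have [v /[!in_itv]/= /andP[v1 v2]] := rat_in_itvoo hlt; exists v.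
  by rewrite ltr_norml; apply/andP; split; lra.
pose p j : rat * rat := (sval (hv j), j%:R / m%:R).
have pE j x : cone L (p j) x = ratr (sval (hv j)) + L%:R * `|x - j%:R / m%:R|.
  by rewrite /cone /= fmorph_div/= !ratr_nat.
exists L, (p 0%N), [seq p j | j <- iota 1 m] => x x01.
have memP q : q \in p 0%N :: [seq p j | j <- iota 1 m] ->
    exists2 j, (j <= m)%N & q = p j.
  rewrite inE => /orP[/eqP->|/mapP[j]]; first by exists 0%N.
  by rewrite mem_iota add1n ltnS => /andP[_ jm] ->; exists j.
have memp j : (j <= m)%N -> p j \in p 0%N :: [seq p j | j <- iota 1 m].
  case: j => [|j] jm; first by rewrite inE eqxx.
  by rewrite inE (map_f p) ?orbT// mem_iota add1n ltnS.
have hvP j : `|ratr (sval (hv j)) - h (j%:R / m%:R)| < e by case: (hv j).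
have [hbx hux] := hn x x01.
have [lm1 lm2] := hm0.
rewrite ler_norml; apply/andP; split.
  rewrite lerBrDl; apply: le_cone_min => q /memP[j jm ->]; rewrite pE.
  have jm01 : 0 <= (j%:R / m%:R : R) <= 1.
    by rewrite divr_ge0//= ler_pdivrMr// mul1r ler_nat.
  have := hvP j; rewrite ltr_norml => /andP[v1 v2].
  have d0 := normr_ge0 (x - j%:R / m%:R); have L0 : (0 : R) <= L%:R by [].
  have [near|far] := ltP `|x - j%:R / m%:R| n.+1%:R^-1.
    by have := hux _ near; rewrite ler_norml => /andP[? ?]; nra.
  have : 2 * n%:R <= L%:R * `|x - j%:R / m%:R|.
    apply: (@le_trans _ _ (L%:R * n.+1%:R^-1)); last by rewrite ler_wpM2l.
    by rewrite /L natrM mulfK ?pnatr_eq0// natrM.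
  have [hbj _] := hn _ jm01; move: hbj hbx; rewrite !ler_norml => /andP[? ?] /andP[? ?].
  by lra.
have [j jm /andP[j1 j2]] := grid_approx (ltn0Sn m0) x01; rewrite -/m in jm j1 j2.
rewrite lerBlDr; apply: le_trans (cone_min_le L x (memp j jm)) _; rewrite pE.
have dE : `|x - j%:R / m%:R| = x - j%:R / m%:R by rewrite ger0_norm// subr_ge0.
have := hvP j; rewrite ltr_norml => /andP[v1 v2].
have near : `|x - j%:R / m%:R| < n.+1%:R^-1.
  by rewrite dE ltrBlDl; apply: lt_trans j2 _; rewrite ltrD2l.
have := hux _ near; rewrite ler_norml => /andP[? ?].
have : L%:R * `|x - j%:R / m%:R| <= L%:R / m%:R.
  by rewrite ler_wpM2l// dE lerBlDl ltW.
by rewrite -/m in lm1; lra.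
Qed.

End lipschitz_family.

(** * Almost sure IC-density *)

Section almost_sure.
Context {R : realType} {d : measure_display} {T : measurableType d}.
Variable P : probability T R.
Variables (N : nat -> {RV P >-> R}) (X : nat -> unitI R -> {RV P >-> R}).
Hypotheses (N_normal : forall n, has_normal_law P (N n) 0 1)
  (N_indep : indep_rvs P (fun n : nat => (N n : T -> R)))
  (X_brownian : forall n, standard_brownian_motion P (fun t => (X n t : T -> R)))
  (X_indep : indep_processes P (fun (n : nat) t => (X n t : T -> R)))
  (NX_indep : indep2 P
     (sigma_gen (fun n : nat => (N n : T -> R)))
     (sigma_gen (fun nt : nat * unitI R => (X nt.1 nt.2 : T -> R)))).

Local Notation path := (path N X).
Local Notation D := (path_diff N X).

(* The first grid index at which a level is reached is close to the first time
   at which the path reaches it. *)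
Let first_index (f : R -> R) (lev q x : R) c L (t := 2 / c%:R) :
  (0 < c)%N -> (0 < L)%N -> 0 <= q <= x -> x + t <= 1 ->
  (forall y, x < y <= x + (c * L)%:R^-1 -> f y <= lev) ->
  exists j, [/\ (j + L <= c * L)%N, q <= j%:R / (c * L)%:R,
    j%:R / (c * L)%:R <= x + (c * L)%:R^-1, f (j%:R / (c * L)%:R) <= lev &
    (forall j', (j' < j)%N -> q <= j'%:R / (c * L)%:R -> lev < f (j'%:R / (c * L)%:R)) /\
    (forall m, (m <= L)%N -> (j + m)%:R / (c * L)%:R <= x + t)].
Proof.
move=> c0 L0 /andP[q0 qx] xt fl; set M := (c * L)%N.
have cR : (0 : R) < c%:R by rewrite ltr0n.
have LR : (0 : R) < L%:R by rewrite ltr0n.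
have M0 : (0 < M)%N by rewrite muln_gt0 c0.
have MR : (0 : R) < M%:R by rewrite ltr0n.
have ME : M%:R = c%:R * L%:R :> R by rewrite natrM.
have MV : M%:R^-1 <= c%:R^-1 :> R by rewrite lef_pV2 ?posrE// ler_nat leq_pmulr.
have tE : t = c%:R^-1 + c%:R^-1 by rewrite /t; ring.
have cV0 : 0 < c%:R^-1 :> R by rewrite invr_gt0.
have x01 : 0 <= x <= 1 by rewrite (le_trans q0)//=; lra.
have [i iM /andP[i1 i2]] := grid_approx M0 x01.
have iS : (i.+1%:R / M%:R : R) = i%:R / M%:R + M%:R^-1.
  by rewrite -natr1 mulrDl mul1r.
pose Q j := q <= j%:R / M%:R /\ f (j%:R / M%:R) <= lev.
(* The grid point just after [x] qualifies, so the first qualifying one comes no later. *)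
have Qi : Q i.+1.
  split; first by rewrite iS (le_trans qx)// ltW.
  by apply: fl; rewrite iS i2/= lerD2r.
have [j [qj fj] jmin] := ex_first (ex_intro _ _ Qi).
have ji : (j <= i.+1)%N.
  by rewrite leqNgt; apply/negP => /jmin.
have jx : j%:R / M%:R <= x + M%:R^-1.
  apply: (@le_trans _ _ (i.+1%:R / M%:R)); last by rewrite iS lerD2r.
  by rewrite ler_pM2r ?invr_gt0// ler_nat.
have jm m : (m <= L)%N -> (j + m)%:R / M%:R <= x + t.
  move=> mL; rewrite natrD mulrDl tE.
  have : m%:R / M%:R <= c%:R^-1 :> R.
    by rewrite ler_pdivrMr// ME mulKf ?gt_eqF// ler_nat.
  by lra.
exists j; split=> //.
- have := le_trans (jm L (leqnn L)) xt.
  by rewrite ler_pdivrMr// mul1r ler_nat.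
- split=> // j' j'j qj'; rewrite ltNge; apply/negP => fj'.
  by apply: (jmin j' j'j); split.
Qed.

(** A grid may miss [x], so the stopping level is raised to [k + om]. From there a difference that
    stays above [k] cannot descend by more than [om], which is the one-sided condition for the
    swapped pair [(b, a)]. *)
Lemma local_min_negligible a b (k q : R) c : a <> b -> (0 < c)%N ->
  P.-negligible [set w | local_min_at (fun x => D a b x w) k q c].
Proof.
move=> ab c0; have ba : b <> a by move=> h; apply: ab.
apply: (stopped_negligible N_indep X_brownian X_indep NX_indep
  (a := a) (b := b) (a' := b) (b' := a) (c := c) (q := q) (lev := fun om => k + om)) => //.
move=> om w om0 [x [qx xc fx fmin]].
have cD : continuous (fun x => D a b x w) by exact: continuous_path_diff.
have [dl dl0 hdl] := continuous_distP x cD om0.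
exists dl => // L M L0 Mdl.
have := @first_index (fun x => D a b x w) (k + om) q x c L c0 L0 qx xc.
case=> [y /andP[xy yM]|j [jM qj jx fj [fj' jm]]].
  have : `|x - y| < dl.
    rewrite distrC gtr0_norm ?subr_gt0// ltrBlDl; apply: le_lt_trans yM _.
    by rewrite ltrD2l.
  by move=> /hdl; rewrite fx ler_norml => /andP[? ?]; lra.
exists j; split=> // m mL.
have : k <= D a b ((j + m)%:R / M%:R) w.
  apply: fmin; rewrite jm// andbT (le_trans qj)//.
  by rewrite ler_wpM2r ?invr_ge0// ler_nat leq_addr.
by move: fj; rewrite /path_diff -/M; lra.
Qed.

(** The grid does come down to [k], first at [x] or within one mesh after it. By continuity the
    value there is at least [k - om], so later values, at most [k], exceed it by at most [om]. *)
Lemma single_descent_negligible a b (k q : R) c : a <> b -> (0 < c)%N ->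
  P.-negligible [set w | single_descent (fun x => D a b x w) k q c].
Proof.
move=> ab c0.
apply: (stopped_negligible N_indep X_brownian X_indep NX_indep
  (a := a) (b := b) (a' := a) (b' := b) (c := c) (q := q) (lev := fun=> k)) => //.
move=> om w om0 [x [qx xc fx fpos fneg]].
have cD : continuous (fun x => D a b x w) by exact: continuous_path_diff.
have [dl dl0 hdl] := continuous_distP x cD om0.
exists dl => // L M L0 Mdl.
have cV : M%:R^-1 <= 2 / c%:R :> R.
  have cR : (0 : R) < c%:R by rewrite ltr0n.
  have : M%:R^-1 <= c%:R^-1 :> R.
    by rewrite lef_pV2 ?posrE ?ltr0n ?muln_gt0 ?c0// ler_nat leq_pmulr.
  have : 0 < c%:R^-1 :> R by rewrite invr_gt0.
  by lra.
have := @first_index (fun x => D a b x w) k q x c L c0 L0 qx xc.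
case=> [y /andP[xy yM]|j [jM qj jx fj [fj' jm]]].
  by apply: fneg; rewrite (ltW xy)/= (le_trans yM)// lerD2l.
have xj : x <= j%:R / M%:R.
  rewrite leNgt; apply/negP => jlt; have : k < D a b (j%:R / M%:R) w.
    by apply: fpos; rewrite qj.
  by rewrite ltNge fj.
have hj : k - om <= D a b (j%:R / M%:R) w.
  have : `|x - j%:R / M%:R| < dl.
    rewrite distrC ger0_norm ?subr_ge0// ltrBlDl; apply: le_lt_trans jx _.
    by rewrite ltrD2l.
  by move=> /hdl; rewrite fx ler_norml => /andP[? ?]; lra.
exists j; split=> // m mL.
have : D a b ((j + m)%:R / M%:R) w <= k.
  apply: fneg; rewrite jm// andbT (le_trans xj)//.
  by rewrite ler_wpM2r ?invr_ge0// ler_nat leq_addr.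
by lra.
Qed.

(** On the grid of mesh 1 the indices [m = 0] and [m = 1] are the two endpoints. *)
Lemma diff_eq_negligible a b (m : nat) (k : R) : a <> b ->
  P.-negligible [set w | D a b (m%:R / 1%:R) w = k].
Proof.
move=> ab; apply: negligible_le => eps eps0.
have e0 : 0 < eps / 3 by rewrite divr_gt0.
pose G w := path a (m%:R / 1%:R) w - k.
have mG : measurable_fun (setT : set (sub_space (grid_incr N X 1) [set x | x.1 <> b])) G.
  apply: measurable_funB; last exact: measurable_cst.
  by apply: measurable_grid_path => // i _ /=.
have := @grid_near_le _ _ _ P N X N_normal N_indep X_brownian X_indep NX_indep
  1 m b G setT _ e0 mG measurableT.
rewrite setTI prob_setT mulr1 mulrCA divff// mulr1 => h.
exists [set w | `|G w - path b (m%:R / 1%:R) w| <= eps / 3]; split=> //.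
  apply: measurable_norm_le_event; apply: measurable_funB; last exact: measurable_path.
  by apply: measurable_funB; [exact: measurable_path|exact: measurable_cst].
move=> w /= Dk; rewrite (_ : G w - _ = 0) ?normr0 ?ltW//.
by rewrite /G -Dk /path_diff; ring.
Qed.

(** Apart from times and the choice of an approximating path, all parameters are discrete, so the
    negation is covered by a countable union of null events. The booleans are the coefficients 0 and
    1 of the planar estimate. *)
Definition good w : Prop :=
  [/\ forall a b m (z : int), a <> b -> D a b (m%:R / 1%:R) w <> z%:~R,
      forall i j k l al be (z1 z2 : int), j <> l -> i <> j -> k <> j -> i <> l -> k <> l ->
        forall x : R, 0 <= x <= 1 -> (al : bool)%:R * path i x w - path j x w = z1%:~R ->
        (be : bool)%:R * path k x w - path l x w = z2%:~R -> False,
      forall a b (z : int), a <> b -> regular_level (fun x => D a b x w) z%:~R &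
      forall L p0 s n, exists a, forall x : R, 0 <= x <= 1 ->
        `|path a x w - cone_min L p0 s x| <= 4 * n.+1%:R^-1].

Lemma not_good_negligible : P.-negligible [set w | ~ good w].
Proof.
have h1 : P.-negligible [set w | exists t : nat * nat * nat * int, t.1.1.1 <> t.1.1.2 /\
    D t.1.1.1 t.1.1.2 (t.1.2%:R / 1%:R) w = t.2%:~R].
  apply: negligible_exists => -[[[a b] m] z] /=; apply: negligible_imply.
  exact: diff_eq_negligible.
have h2 : P.-negligible [set w | exists t : (nat * nat * nat * nat) * (bool * bool) * (int * int),
    let: ((i, j, k, l), (al, be), (z1, z2)) := t in
    [/\ j <> l, i <> j, k <> j, i <> l & k <> l] /\ exists x : R, [/\ 0 <= x <= 1,
      al%:R * path i x w - path j x w = z1%:~R &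
      be%:R * path k x w - path l x w = z2%:~R]].
  apply: negligible_exists => -[[[[[i j] k] l] [al be]] [z1 z2]]; apply: negligible_imply.
  move=> [jl ij kj il kl].
  have b1 (c : bool) : `|c%:R : R| <= 1 by case: c; rewrite /= ?normr1 ?normr0.
  exact: (planar_misses_point N_normal N_indep X_brownian X_indep NX_indep).
have h3 : P.-negligible [set w | exists t : nat * nat * int * (rat * nat),
    let: ((a, b, z), (q, c)) := t in a <> b /\
    (local_min_at (fun x => D a b x w) z%:~R (ratr q) c.+1 \/
     single_descent (fun x => D a b x w) z%:~R (ratr q) c.+1)].
  apply: negligible_exists => -[[[a b] z] [q c]]; apply: negligible_imply => ab.
  by apply: negligibleU; [exact: local_min_negligible|exact: single_descent_negligible].
have h4 : P.-negligible [set w | exists t : nat * (rat * rat) * seq (rat * rat) * nat,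
    let: (L, p0, s, n) := t in forall a, exists2 x : R, 0 <= x <= 1 &
      4 * n.+1%:R^-1 < `|path a x w - cone_min L p0 s x|].
  apply: negligible_exists => -[[[L p0] s] n].
  apply: (not_approximated_negligible N_normal N_indep X_brownian X_indep NX_indep
    (Lc := L%:R)) => //.
  exact: cone_min_lipschitz.
apply: negligibleS (negligibleU (negligibleU h1 h2) (negligibleU h3 h4)) => w ngood.
apply: contrapT => nw; apply: ngood; split.
- by move=> a b m z ab Dz; apply: nw; left; left; exists (a, b, m, z).
- move=> i j k l al be z1 z2 jl ij kj il kl x x01 e1 e2.
  apply: nw; left; right; exists ((i, j, k, l), (al, be), (z1, z2)); split=> //.
  by exists x.
- move=> a b z ab q c; split=> h; apply: nw; right; left;
    exists ((a, b, z), (q, c)); split=> //; by [left|right].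
- move=> L p0 s n; apply: contrapT => h; apply: nw; right; right.
  exists (L, p0, s, n) => a; apply: contrapT => h'; apply: h; exists a => x x01.
  by rewrite leNgt; apply/negP => lt; apply: h'; exists x.
Qed.

Lemma good_IC_dense w : good w ->
  IC_dense (range (fun (n : nat) (t : unitI R) => N n w + X n t w)).
Proof.
move=> [endpt planar reg dens].
pose F n (t : unitI R) : R := N n w + X n t w.
have FE n t : F n t = path n (set_val t) w by rewrite /path clipK.
have int_diff a b x : cr (F a) (F b) x ->
    exists z : int, 1 * path a (set_val x) w - path b (set_val x) w = z%:~R.
  rewrite /cr /= !FE => /fracpart_eq h; eexists; rewrite mul1r; exact: h.
have neq a b : F a <> F b -> a <> b by move=> h ab; apply: h; rewrite ab.
split.
- exact: sub_countable (card_image_le _ _) (countableP _).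
- move=> _ [n _ <-] t; have h : {for t, continuous (fun t => X n t w)}.
    exact: (bm_continuous (X_brownian n)).
  exact: cvgD (cvg_cst _) h.
- move=> g cg e e0; have ch : continuous (g \o clip).
    move=> x; apply: continuous_comp; first exact: continuous_clip.
    exact: cg.
  (* The two errors add up to [3 * (e / 6) + 4 * (e / 16) = 3 * e / 4], which leaves a strict margin
     for the supremum. *)
  have e60 : 0 < e / 6 by rewrite divr_gt0.
  have e160 : 0 < e / 16 by rewrite divr_gt0.
  have [L [p0 [s hs]]] := cone_min_dense ch e60.
  have [n hn] := ltr_inv_nat e160; have [a ha] := dens L p0 s n.
  exists (F a); first by exists a.
  apply: (@le_lt_trans _ _ (3 * e / 4)); last by lra.
  apply: ge_sup; first by exists `|(F a \- g) (unitI0 R)|; exists (unitI0 R).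
  move=> _ [t _ <-] /=; have := ha _ (unitI_itv t); have := hs _ (unitI_itv t).
  rewrite /= clipK -FE => b1 b2.
  have b3 : 4 * n.+1%:R^-1 <= e / 4.
    by move: (n.+1%:R^-1) (hn n (leqnn n)) => u; lra.
  have {}b2 := le_trans b2 b3; clear b3.
  have := ler_normD (F a t - cone_min L p0 s (set_val t))
    (cone_min L p0 s (set_val t) - g t).
  by rewrite addrA subrK; lra.
- move=> _ _ _ _ [a _ <-] [b _ <-] [a' _ <-] [b' _ <-]; rewrite -!/(F _).
  move=> ab ab' sets; apply/seteqP; split=> // x [/= c1 c2].
  have [z1 e1] := int_diff _ _ _ c1; have [z2 e2] := int_diff _ _ _ c2.
  have x01 := unitI_itv x.
  have swap i j (z : int) : 1 * path i (set_val x) w - path j (set_val x) w = z%:~R ->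
      1 * path j (set_val x) w - path i (set_val x) w = (- z)%:~R.
    by rewrite rmorphN/= => <-; ring.
  (* Distinct pairs share at most one path. The cases below orient both differences so that a shared
     path takes the places [i] and [k], which may coincide. *)
  have key i j k l (z1' z2' : int) : F i <> F j -> F k <> F l ->
      F j <> F k -> F j <> F l -> F l <> F i ->
      1 * path i (set_val x) w - path j (set_val x) w = z1'%:~R ->
      1 * path k (set_val x) w - path l (set_val x) w = z2'%:~R -> False.
    move=> /neq ij /neq kl /neq jk /neq jl /neq li E1 E2.
    by apply: (planar i j k l true true z1' z2' _ _ _ _ _ (set_val x)) => //; exact: nesym.
  have [aa'|aa'] := pselect (F a = F a').
    have bb' : F b <> F b' by move=> h; apply: sets; rewrite aa' h.
    have [ba'|ba'] := pselect (F b = F a'); first by apply: ab; rewrite aa' ba'.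
    apply: (key a b a' b' z1 z2) => //; first by move=> h; apply: ab'; rewrite -aa' h.
  have [ab2|ab2] := pselect (F a = F b').
    have ba' : F b <> F a'.
      by move=> h; apply: sets; rewrite ab2 h; apply/seteqP; split=> y /= [->|->]; auto.
    apply: (key a b b' a' z1 (- z2)) => //; last exact: swap.
    + exact: nesym.
    + by move=> h; apply: ab; rewrite ab2 h.
    + exact: nesym.
  have [ba'|ba'] := pselect (F b = F a').
    apply: (key b a a' b' (- z1) z2) => //; last exact: (swap _ _ _ e1).
    + exact: nesym.
    + by move=> h; apply: ab'; rewrite -ba' h.
  apply: (key b a b' a' (- z1) (- z2)) => //; try exact: swap; try exact: nesym.
- move=> _ _ [a _ <-] [b _ <-]; rewrite -!/(F _) => /neq ab x /int_diff[z].
  rewrite mul1r => h; split=> x0.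
    by apply: (endpt a b 0%N z ab); rewrite mul0r -x0.
  by move: h; rewrite x0 => h; apply: (endpt a b 1%N z ab); rewrite divff ?oner_neq0.
- move=> _ _ [a _ <-] [b _ <-]; rewrite -!/(F _) => /neq ab x x01 frac.
  rewrite (_ : F a = fun t => path a (set_val t) w); last by apply/funext => t; exact: FE.
  rewrite (_ : F b = fun t => path b (set_val t) w); last by apply/funext => t; exact: FE.
  apply: (@alternates_of_crossing _ (fun x => path a x w) (fun x => path b x w)) => //.
  + exact: continuous_path.
  + exact: continuous_path.
  + by rewrite -!FE.
  + move=> [z1 [z2 [e1 e2]]].
    (* With coefficients 0 the auxiliary path [i] drops out, and [planar] says that [a] and [b]
       never take integer values at the same time. *)
    have [i ia ib] : exists2 i, i <> a & i <> b.
      by exists (a + b).+1; lia.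
    apply: (planar i a i b false false (- z1) (- z2) ab ia ia ib ib _ (unitI_itv x)).
      by rewrite mul0r sub0r e1 rmorphN.
    by rewrite mul0r sub0r e2 rmorphN.
  + by move=> z; exact: reg.
  + by move=> z; apply: reg; exact: nesym.
Qed.

End almost_sure.

Theorem theorem13 (R : realType) (d : measure_display) (T : measurableType d)
    (P : probability T R)
    (N : nat -> {RV P >-> R}) (X : nat -> unitI R -> {RV P >-> R})
    (N_normal : forall n, has_normal_law P (N n) 0 1)
    (N_indep : indep_rvs P (fun n : nat => (N n : T -> R)))
    (X_brownian : forall n,
       standard_brownian_motion P (fun t => (X n t : T -> R)))
    (X_indep : indep_processes P (fun (n : nat) t => (X n t : T -> R)))
    (NX_indep : indep2 P
       (sigma_gen (fun n : nat => (N n : T -> R)))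
       (sigma_gen (fun nt : nat * unitI R => (X nt.1 nt.2 : T -> R)))) :
  {ae P, forall w : T,
     IC_dense (range (fun (n : nat) (t : unitI R) => N n w + X n t w))}.
Proof.
apply: negligibleS (not_good_negligible N_normal N_indep X_brownian X_indep NX_indep).
by move=> w; apply: contra_not; exact: good_IC_dense.
Qed.
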